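(* Let $R\subseteq S$ be a separable ring extension such that $R$ is Artinian and reduced. Then: (1) $R\to S$ is module-finite and étale. (2) $R\to S$ has FIP and is seminormal. Moreover, $|[R,S]|\leq\prod_{M\in\mathrm{MSupp}_R(S/R)}B_{n_M}$, where $n_M=\dim_{R/M}(S/MS)$.
   Context: All rings are commutative, unital and nonzero. A ring morphism $R\to S$ is separable if $S$ is a projective $S\otimes_RS$-module via the multiplication map $S\otimes_RS\to S$. A ring morphism is étale if it is flat, of finite presentation, and $\Omega_{S|R}=0$. For a ring extension $R\subseteq S$, $[R,S]$ is the set of all $R$-subalgebras of $S$; the extension has FIP if $[R,S]$ is finite, and is seminormal if $b\in S$ and $b^2,b^3\in R$ imply $b\in R$. For an $R$-module $E$, $\mathrm{MSupp}_R(E)=\{M\in\mathrm{Max}(R)\mid E_M\neq0\}$. $B_n$ is the $n$th Bell number, i.e. the number of partitions of $\{1,\ldots,n\}$. *)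

(* Defs.v *)
From HB Require Import structures.
From mathcomp Require Import all_boot all_order all_algebra.
From mathcomp Require Import boolp classical_sets functions cardinality fsbigop.
From mathcomp Require Import freeg mpoly.

Set Implicit Arguments.
Unset Strict Implicit.
Unset Printing Implicit Defensive.

Import GRing.Theory.
Local Open Scope ring_scope.
Local Open Scope classical_set_scope.
Local Open Scope quotient_scope.

Section Span.
Variables (R : pzRingType) (E : lmodType R).
Implicit Types (N : set E) (x y : E).

(* The smallest submodule containing N; for E := R^o this is the ideal
   generated by N, possibly R itself. *)
Definition mspan N : set E :=
  [set x | forall P : set E, GRing.submod_closed (mem P) -> N `<=` P -> P x].

Lemma sub_mspan N : N `<=` mspan N.
Proof. by move=> x Nx P _; apply. Qed.

Lemma mspan_sub N (P : set E) :
  GRing.submod_closed (mem P) -> N `<=` P -> mspan N `<=` P.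
Proof. by move=> sP NP x; apply. Qed.

Lemma mspan0 N : mspan N 0.
Proof. by move=> P [P0 _] _; rewrite inE in P0. Qed.

Lemma mspanZD N a x y : mspan N x -> mspan N y -> mspan N (a *: x + y).
Proof.
move=> Nx Ny P sP NP; have [_ PZD] := sP.
by have := PZD a x y; rewrite !inE; apply; [apply: Nx | apply: Ny].
Qed.

Definition in_mspan N : {pred E} := fun x => `[< mspan N x >].

Lemma in_mspanE N x : x \in in_mspan N <-> mspan N x.
Proof. by rewrite unfold_in; split => /asboolP. Qed.

Lemma in_mspan_zmod_closed N : zmod_closed (in_mspan N).
Proof.
split=> [|x y /in_mspanE Nx /in_mspanE Ny]; apply/in_mspanE; first exact: mspan0.
by rewrite addrC -scaleN1r; apply: mspanZD.
Qed.

HB.instance Definition _ N :=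
  GRing.isZmodClosed.Build E (in_mspan N) (in_mspan_zmod_closed N).

End Span.

(* E / <N>, for an arbitrary subset N of E. *)
Definition quotmod (R : pzRingType) (E : lmodType R) (N : set E) :=
  Quotient.quot (in_mspan N).

Section QuotMod.
Variables (R : pzRingType) (E : lmodType R) (N : set E).

HB.instance Definition _ := GRing.Zmodule.on (quotmod N).

Definition qpi (x : E) : quotmod N := \pi_(Quotient.quot (in_mspan N)) x.
Definition qrepr (q : quotmod N) : E := repr (q : Quotient.quot (in_mspan N)).

Lemma qreprK q : qpi (qrepr q) = q.
Proof. exact: reprK. Qed.

Lemma qpi_eq x y : qpi x = qpi y <-> mspan N (x - y).
Proof.
rewrite -in_mspanE Quotient.idealrBE.
by split=> [/eqP|/eqP].
Qed.

Lemma qpi_eq0 x : qpi x = 0 <-> mspan N x.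
Proof. by rewrite -[x in mspan N x]subr0 -qpi_eq /qpi !piE. Qed.

Lemma qpiD x y : qpi (x + y) = qpi x + qpi y.
Proof. by rewrite /qpi !piE. Qed.

Definition qscale (a : R) (q : quotmod N) : quotmod N := qpi (a *: qrepr q).

Lemma qscale_pi a x : qscale a (qpi x) = qpi (a *: x).
Proof.
apply/qpi_eq; rewrite -scalerBr -[a *: _]addr0.
apply: mspanZD; last exact: mspan0.
by apply/qpi_eq; rewrite qreprK.
Qed.

Lemma qscaleA a b q : qscale a (qscale b q) = qscale (a * b) q.
Proof. by rewrite -[q]qreprK !qscale_pi scalerA. Qed.

Lemma qscale1 : left_id 1 qscale.
Proof. by move=> q; rewrite -[q]qreprK qscale_pi scale1r. Qed.

Lemma qscaleDr : right_distributive qscale +%R.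
Proof.
by move=> a p q; rewrite -[p]qreprK -[q]qreprK -qpiD !qscale_pi scalerDr qpiD.
Qed.

Lemma qscaleDl q : {morph qscale^~ q : a b / a + b}.
Proof. by move=> a b; rewrite -[q]qreprK !qscale_pi scalerDl qpiD. Qed.

HB.instance Definition _ := GRing.Zmodule_isLmodule.Build R (quotmod N)
  qscaleA qscale1 qscaleDr qscaleDl.

Lemma qpi_is_linear : linear qpi.
Proof. by move=> a x y; rewrite qpiD -qscale_pi. Qed.

HB.instance Definition _ := GRing.isLinear.Build R E (quotmod N) *:%R qpi
  qpi_is_linear.

End QuotMod.

Arguments qpi {R E} N x.

(* R / <I>, for an arbitrary subset I of R. *)
Definition quotring (R : comPzRingType) (I : set R) := quotmod (I : set R^o).

Section QuotRing.
Variables (R : comPzRingType) (I : set R).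
Local Notation Q := (quotring I).

HB.instance Definition _ := GRing.Zmodule.on Q.

Definition qrpi (a : R) : Q := qpi (I : set R^o) a.
Definition qrrepr (q : Q) : R := @qrepr R R^o I q.

Lemma qrreprK q : qrpi (qrrepr q) = q.
Proof. exact: qreprK. Qed.

Lemma qrpi_eq a b : qrpi a = qrpi b <-> mspan (I : set R^o) (a - b).
Proof. exact: (@qpi_eq R R^o). Qed.

Lemma qrpiD a b : qrpi (a + b) = qrpi a + qrpi b.
Proof. exact: (@qpiD R R^o). Qed.

Definition qrmul (p q : Q) : Q := qrpi (qrrepr p * qrrepr q).

Lemma qrmulC : commutative qrmul.
Proof. by move=> p q; rewrite /qrmul mulrC. Qed.

Lemma qrmul_pi a b : qrmul (qrpi a) (qrpi b) = qrpi (a * b).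
Proof.
have piM c d : qrpi (c * qrrepr (qrpi d)) = qrpi (c * d).
  by have := @qscale_pi R R^o I c d.
by rewrite /qrmul piM mulrC piM mulrC.
Qed.

Lemma qrmulA : associative qrmul.
Proof.
move=> p q r; rewrite -[p]qrreprK -[q]qrreprK -[r]qrreprK.
by rewrite !qrmul_pi mulrA.
Qed.

Lemma qrmul1 : left_id (qrpi 1) qrmul.
Proof. by move=> p; rewrite -[p]qrreprK qrmul_pi mul1r. Qed.

Lemma qrmulDl : left_distributive qrmul +%R.
Proof.
move=> p q r; rewrite -[p]qrreprK -[q]qrreprK -[r]qrreprK.
by rewrite -qrpiD !qrmul_pi mulrDl qrpiD.
Qed.

HB.instance Definition _ := GRing.Zmodule_isComPzRing.Build Q
  qrmulA qrmulC qrmul1 qrmulDl.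

Lemma qrpi_is_zmod_morphism : zmod_morphism qrpi.
Proof. by move=> a b; apply: (linearB (qpi (I : set R^o))). Qed.

Lemma qrpi_is_monoid_morphism : monoid_morphism qrpi.
Proof. by split=> // a b; rewrite -qrmul_pi. Qed.

HB.instance Definition _ := GRing.isZmodMorphism.Build R Q qrpi
  qrpi_is_zmod_morphism.
HB.instance Definition _ := GRing.isMonoidMorphism.Build R Q qrpi
  qrpi_is_monoid_morphism.

End QuotRing.

Arguments qrpi {R} I a.

Definition ideal_mul (R : comPzRingType) (I : set R) (E : lmodType R) : set E :=
  [set z : E | exists2 a, I a & exists x : E, z = a *: x].
Arguments ideal_mul {R} I E _.

(* E / IE, whose canonical module structure below is over R / <I>. *)
Definition fibre (R : comPzRingType) (I : set R) (E : lmodType R) :=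
  quotmod (ideal_mul I E).

Section Fibre.
Variables (R : comPzRingType) (I : set R) (E : lmodType R).
Local Notation F := (fibre I E).

HB.instance Definition _ := GRing.Zmodule.on F.

Definition fpi (x : E) : F := qpi _ x.
Definition frepr (q : F) : E := qrepr q.

Lemma freprK q : fpi (frepr q) = q.
Proof. exact: qreprK. Qed.

Lemma fpiD x y : fpi (x + y) = fpi x + fpi y.
Proof. exact: qpiD. Qed.

Definition fscale (a : quotring I) (q : F) : F := fpi (qrrepr a *: frepr q).

Lemma fscale_pi a x : fscale (qrpi I a) (fpi x) = fpi (a *: x).
Proof.
rewrite /fscale; set b := qrrepr _.
have -> : fpi (b *: frepr (fpi x)) = fpi (b *: x) by exact: qscale_pi.
apply/qpi_eq; rewrite {}/b; rewrite -scalerBl.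
pose P : set R^o := [set b : R^o | mspan (ideal_mul I E) ((b : R) *: x)].
suff sIP : mspan (I : set R^o) `<=` P.
  by apply: sIP; apply/qrpi_eq; rewrite qrreprK.
apply: mspan_sub => [|b Ib]; last by apply: sub_mspan; exists b => //; exists x.
split=> [|c u v]; rewrite !inE /P /= ?scale0r; first exact: mspan0.
by move=> Pu Pv; rewrite scalerDl -scalerA; apply: mspanZD.
Qed.

Lemma fscaleA a b q : fscale a (fscale b q) = fscale (a * b) q.
Proof.
rewrite -[q]freprK -[a]qrreprK -[b]qrreprK.
by rewrite -rmorphM !fscale_pi scalerA.
Qed.

Lemma fscale1 : left_id 1 fscale.
Proof.
by move=> q; rewrite -[q]freprK -(rmorph1 (qrpi I)) fscale_pi scale1r.
Qed.

Lemma fscaleDr : right_distributive fscale +%R.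
Proof.
move=> a p q; rewrite -[p]freprK -[q]freprK -[a]qrreprK.
by rewrite -fpiD !fscale_pi scalerDr fpiD.
Qed.

Lemma fscaleDl q : {morph fscale^~ q : a b / a + b}.
Proof.
move=> a b; rewrite -[q]freprK -[a]qrreprK -[b]qrreprK.
by rewrite -rmorphD !fscale_pi scalerDl fpiD.
Qed.

HB.instance Definition _ := GRing.Zmodule_isLmodule.Build (quotring I) F
  fscaleA fscale1 fscaleDr fscaleDl.

End Fibre.

Arguments fpi {R I E} x.

(* The size of a finite basis of V over K; 0 if there is none. *)
Definition dimension (K : comPzRingType) (V : lmodType K) : nat :=
  xget 0%N [set n | exists b : 'I_n -> V,
    bijective (fun c : {ffun 'I_n -> K} => \sum_i c i *: b i)].

Section Tensor.
Variables (R : comNzRingType) (M N : lmodType R).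

Local Notation gen x y := (<< ((x, y) : M * N) >> : {freeg (M * N) / R}).

Inductive tens_rel : set {freeg (M * N) / R} :=
| TensDl x x' y : tens_rel (gen (x + x') y - gen x y - gen x' y)
| TensDr x y y' : tens_rel (gen x (y + y') - gen x y - gen x y')
| TensZl a x y : tens_rel (gen (a *: x) y - a *: gen x y)
| TensZr a x y : tens_rel (gen x (a *: y) - a *: gen x y).

Definition tensor := quotmod tens_rel.
HB.instance Definition _ := GRing.Lmodule.on tensor.

Definition tens (x : M) (y : N) : tensor := qpi tens_rel (gen x y).

Lemma tensDl x x' y : tens (x + x') y = tens x y + tens x' y.
Proof.
rewrite /tens -qpiD; apply/qpi_eq; apply: sub_mspan.
by rewrite opprD addrA; apply: TensDl.
Qed.

Lemma tensDr x y y' : tens x (y + y') = tens x y + tens x y'.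
Proof.
rewrite /tens -qpiD; apply/qpi_eq; apply: sub_mspan.
by rewrite opprD addrA; apply: TensDr.
Qed.

Lemma tensZl a x y : tens (a *: x) y = a *: tens x y.
Proof. by rewrite /tens -linearZ; apply/qpi_eq; apply: sub_mspan; apply: TensZl. Qed.

Lemma tensZr a x y : tens x (a *: y) = a *: tens x y.
Proof. by rewrite /tens -linearZ; apply/qpi_eq; apply: sub_mspan; apply: TensZr. Qed.

Lemma tens_ind (P : tensor -> Prop) :
    P 0 -> (forall x y t, P t -> P (tens x y + t)) -> forall t, P t.
Proof.
move=> P0 PD t; rewrite -[t]qreprK -[qrepr t]freeg_sumE.
rewrite linear_sum; elim: (dom _) => [|[x y] s IH]; first by rewrite big_nil.
rewrite big_cons /=; set k := coeff _ _.
suff -> : qpi tens_rel << k *g (x, y) >> = tens (k *: x) y by exact: PD.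
rewrite tensZl /tens -linearZ; congr (qpi _ _); apply/eqP/freeg_eqP => z.
by rewrite coeffZ !coeffU mul1r.
Qed.

End Tensor.

Definition bilinear_map (R : comNzRingType) (M N P : lmodType R)
    (f : M -> N -> P) :=
  (forall y, linear (f^~ y)) /\ (forall x, linear (f x)).

(* The map tensor M N -> P induced by f, meaningful for f bilinear. *)
Definition tlift (R : comNzRingType) (M N P : lmodType R) (f : M -> N -> P)
    (t : tensor M N) : P :=
  fglift (fun z : M * N => f z.1 z.2) (qrepr t).

Section FgLift.
Variables (R : comNzRingType) (K : choiceType) (P : lmodType R) (g : K -> P).

Lemma fglift_is_linear : linear (fglift g : {freeg K / R} -> P).
Proof.
pose G : {additive {freeg K / R} -> P} := HB.pack (fglift g)
  (GRing.isZmodMorphism.Build _ _ _ (lift_is_additive g)).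
move=> a D D'; rewrite -![fglift g _]/(G _) raddfD; congr (_ + _).
rewrite -[D in RHS]freeg_sumE -[a *: D]/(fgscale a D) !raddf_sum.
by apply: eq_bigr => z _; rewrite /= !liftU scalerA.
Qed.

HB.instance Definition _ := GRing.isLinear.Build R {freeg K / R} P *:%R
  (fglift g) fglift_is_linear.

End FgLift.

Section Lift.
Variables (R : comNzRingType) (M N P : lmodType R) (f : M -> N -> P).
Hypothesis f_bil : bilinear_map f.

Let g (z : M * N) := f z.1 z.2.

Lemma fglift_tens_rel D : mspan (@tens_rel R M N) D -> fglift g D = 0.
Proof.
case: f_bil => fl fr.
have fDl x x' y : f (x + x') y = f x y + f x' y.
  by have := fl y 1 x x'; rewrite !scale1r.
have fDr x y y' : f x (y + y') = f x y + f x y'.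
  by have := fr x 1 y y'; rewrite !scale1r.
have f0l y : f 0 y = 0 by apply: (addrI (f 0 y)); rewrite -fDl !addr0.
have f0r x : f x 0 = 0 by apply: (addrI (f x 0)); rewrite -fDr !addr0.
suff : mspan (@tens_rel R M N) `<=` [set D | fglift g D = 0] by apply.
apply: mspan_sub => [|_ [x x' y|x y y'|a x y|a x y]] /=.
- split=> [|a u v]; rewrite !inE /= ?linear0 // => gu gv.
  by rewrite linearP /= gu gv scaler0 addr0.
- by rewrite !linearB /= !liftU /g /= !scale1r fDl addrAC addrK subrr.
- by rewrite !linearB /= !liftU /g /= !scale1r fDr addrAC addrK subrr.
- rewrite linearB linearZ /= !liftU /g /= !scale1r.
  by have := fl y a x 0; rewrite f0l !addr0 => ->; rewrite subrr.
- rewrite linearB linearZ /= !liftU /g /= !scale1r.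
  by have := fr x a y 0; rewrite f0r !addr0 => ->; rewrite subrr.
Qed.

Lemma tlift_qpi D : tlift f (qpi _ D) = fglift g D.
Proof.
apply/eqP; rewrite -subr_eq0 -linearB; apply/eqP/fglift_tens_rel.
by apply/qpi_eq; rewrite qreprK.
Qed.

Lemma tliftE x y : tlift f (tens x y) = f x y.
Proof. by rewrite tlift_qpi liftU scale1r. Qed.

Lemma tlift_linear : linear (tlift f).
Proof.
move=> a s t; rewrite -[s]qreprK -[t]qreprK -linearP !tlift_qpi.
by rewrite linearP.
Qed.

End Lift.

(* id_M (x) h *)
Definition tmap (R : comNzRingType) (M N N' : lmodType R)
    (h : {linear N -> N'}) : tensor M N -> tensor M N' :=
  tlift (fun x y => tens x (h y)).

Lemma tmapE (R : comNzRingType) (M N N' : lmodType R)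
  (h : {linear N -> N'}) x y : tmap h (tens x y) = tens x (h y) :> tensor M N'.
Proof.
apply: tliftE; split=> [{}y|{}x] a u v; first by rewrite tensDl tensZl.
by rewrite linearP tensDr tensZr.
Qed.

Section TensorAlgebra.
Variables (R : comNzRingType) (S : comAlgType R).
Local Notation T := (tensor S S).

(* talg is S (x)_R S as a ring: an alias of tensor S S. *)
Definition talg := T.
HB.instance Definition _ := GRing.Lmodule.on talg.

Definition tmull (a b : S) : T -> T := tlift (fun x y => tens (a * x) (b * y)).

Definition tmul (s t : talg) : talg := tlift (fun a b => tmull a b t) s.

Lemma tmull_bil a b :
  bilinear_map (fun x y : S => tens (a * x) (b * y)).
Proof.
split=> [y|x] c u v.
  by rewrite mulrDr -scalerAr tensDl tensZl.
by rewrite mulrDr -scalerAr tensDr tensZr.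
Qed.

Lemma tmull_linear a b : linear (tmull a b).
Proof. exact: tlift_linear (tmull_bil a b). Qed.

Lemma tmull0 a b : tmull a b 0 = 0.
Proof.
have := tmull_linear a b (-1) 0 0.
by rewrite scaler0 addr0 scaleN1r addrC subrr.
Qed.

Lemma tmullD a b s t : tmull a b (s + t) = tmull a b s + tmull a b t.
Proof. by have := tmull_linear a b 1 s t; rewrite !scale1r. Qed.

Lemma tmullE a b x y : tmull a b (tens x y) = tens (a * x) (b * y).
Proof. exact: tliftE (tmull_bil a b) _ _. Qed.

Lemma tmul_bil t : bilinear_map (fun a b => tmull a b t).
Proof.
elim/tens_ind: t => [|x y t [IHl IHr]].
  by split=> ? ? ? ?; rewrite !tmull0 scaler0 addr0.
split=> [b|a] c u v; rewrite !tmullD !tmullE.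
  rewrite IHl mulrDl -scalerAl tensDl tensZl scalerDr -!addrA.
  by congr (_ + _); rewrite addrCA.
rewrite IHr mulrDl -scalerAl tensDr tensZr scalerDr -!addrA.
by congr (_ + _); rewrite addrCA.
Qed.

Lemma tmul_tens a b t : tmul (tens a b) t = tmull a b t.
Proof. exact: tliftE (tmul_bil t) _ _. Qed.

Lemma tmulE a b x y : tmul (tens a b) (tens x y) = tens (a * x) (b * y).
Proof. by rewrite tmul_tens tmullE. Qed.

Lemma tmulDl : left_distributive tmul +%R.
Proof.
by move=> s s' t; have := tlift_linear (tmul_bil t) 1 s s'; rewrite !scale1r.
Qed.

Lemma tmul0l t : tmul 0 t = 0.
Proof. by apply: (addrI (tmul 0 t)); rewrite -tmulDl !addr0. Qed.

Lemma tmul0r t : tmul t 0 = 0.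
Proof.
elim/tens_ind: t => [|a b t IH]; first exact: tmul0l.
by rewrite tmulDl IH tmul_tens tmull0 addr0.
Qed.

Lemma tmulDr : right_distributive tmul +%R.
Proof.
move=> s t t'; elim/tens_ind: s => [|a b s IH]; first by rewrite !tmul0l addr0.
by rewrite !tmulDl !tmul_tens tmullD IH addrACA.
Qed.

Lemma tmulC : commutative tmul.
Proof.
move=> s t; elim/tens_ind: s => [|a b s IH]; first by rewrite tmul0l tmul0r.
rewrite tmulDl tmulDr IH; congr (_ + _).
elim/tens_ind: t {IH} => [|x y t IH]; first by rewrite tmul0l tmul0r.
by rewrite tmulDl tmulDr IH !tmulE [a * x]mulrC [b * y]mulrC.
Qed.

Lemma tmulA : associative tmul.
Proof.
move=> s t u.
elim/tens_ind: s => [|a b s IHs]; first by rewrite !tmul0l.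
rewrite !tmulDl IHs; congr (_ + _) => {IHs}.
elim/tens_ind: t => [|x y t IHt]; first by rewrite !(tmul0l, tmul0r).
rewrite !(tmulDl, tmulDr) IHt; congr (_ + _) => {IHt}.
elim/tens_ind: u => [|z w u IHu]; first by rewrite !tmul0r.
by rewrite !tmulDr IHu !tmulE !mulrA.
Qed.

Lemma tmul1 : left_id (tens 1 1 : talg) tmul.
Proof.
elim/tens_ind => [|x y t IH]; first exact: tmul0r.
by rewrite tmulDr IH tmulE !mul1r.
Qed.

HB.instance Definition _ := GRing.Zmodule_isComPzRing.Build talg
  tmulA tmulC tmul1 tmulDl.

Definition tprod : talg -> S := tlift (fun x y : S => x * y).

Lemma mulr_bil : bilinear_map (fun x y : S => x * y).
Proof.
by split=> [y|x] c u v; rewrite (mulrDl, mulrDr) (=^~ scalerAl, =^~ scalerAr).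
Qed.

Lemma tprodE x y : tprod (tens x y) = x * y.
Proof. exact: tliftE mulr_bil _ _. Qed.

Lemma tprod_is_zmod_morphism : zmod_morphism tprod.
Proof.
move=> s t; have := tlift_linear mulr_bil (-1) t s; rewrite !scaleN1r => e.
by rewrite addrC [RHS]addrC; exact: e.
Qed.

HB.instance Definition _ := GRing.isZmodMorphism.Build talg S tprod
  tprod_is_zmod_morphism.

Lemma tprod_is_monoid_morphism : monoid_morphism tprod.
Proof.
split=> [|s t]; first by rewrite tprodE mulr1.
elim/tens_ind: s => [|a b s IH]; first by rewrite mul0r !raddf0 mul0r.
rewrite mulrDl !raddfD /= mulrDl IH; congr (_ + _) => {IH}.
elim/tens_ind: t => [|x y t IH]; first by rewrite mulr0 !raddf0 mulr0.
rewrite mulrDr !raddfD /= mulrDr IH; congr (_ + _) => {IH}.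
by rewrite [_ * _]tmulE !tprodE mulrACA.
Qed.

HB.instance Definition _ := GRing.isMonoidMorphism.Build talg S tprod
  tprod_is_monoid_morphism.

End TensorAlgebra.

(* S as a module over T via g : T -> S. *)
Definition restr (T S : pzRingType) (g : {rmorphism T -> S}) : Type := S.

Section Restr.
Variables (T S : pzRingType) (g : {rmorphism T -> S}).

HB.instance Definition _ := GRing.Zmodule.on (restr g).

Definition rscale (t : T) (x : restr g) : restr g := g t * (x : S).

Lemma rscaleA a b x : rscale a (rscale b x) = rscale (a * b) x.
Proof. by rewrite /rscale rmorphM mulrA. Qed.

Lemma rscale1 : left_id 1 rscale.
Proof. by move=> x; rewrite /rscale rmorph1 mul1r. Qed.

Lemma rscaleDr : right_distributive rscale +%R.
Proof. by move=> a x y; apply: mulrDr. Qed.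

Lemma rscaleDl x : {morph rscale^~ x : a b / a + b}.
Proof. by move=> a b; rewrite /rscale rmorphD; apply: mulrDl. Qed.

HB.instance Definition _ := GRing.Zmodule_isLmodule.Build T (restr g)
  rscaleA rscale1 rscaleDr rscaleDl.

End Restr.

(* The modules A and B range over those whose carriers live in the fixed
   universe of the MathComp structures; likewise for flat below. *)
Definition projective (T : pzRingType) (P : lmodType T) : Prop :=
  forall (A B : lmodType T) (p : {linear A -> B}) (h : {linear P -> B}),
    (forall b, exists a, p a = b) ->
    exists l : {linear P -> A}, forall x, p (l x) = h x.

Definition separable_algebra (R : comNzRingType) (S : comAlgType R) : Prop :=
  projective (restr (@tprod R S)).

Definition module_finite (R : pzRingType) (E : lmodType R) : Prop :=
  exists s : seq E, mspan [set` s] = setT.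

Definition flat (R : comNzRingType) (E : lmodType R) : Prop :=
  forall (M N : lmodType R) (h : {linear M -> N}),
    injective h -> injective (@tmap R E M N h).

Definition finitely_presented (R : comNzRingType) (S : comAlgType R) : Prop :=
  exists n (g : {lrmorphism {mpoly R[n]} -> S}),
    (forall x, exists p, g p = x) /\
    exists s : seq {mpoly R[n]},
      [set p | g p = 0] = mspan ([set` s] : set {mpoly R[n]}^o).

(* The module of Kaehler differentials: the free S-module on symbols d x for
   x in S, modulo additivity, the Leibniz rule and d r = 0 for r in R. *)
Section Kaehler.
Variables (R : comNzRingType) (S : comAlgType R).

Local Notation d x := (<< (x : S) >> : {freeg S / S}).

Inductive kaehler_rel : set {freeg S / S} :=
| KaehlerD x y : kaehler_rel (d (x + y) - d x - d y)
| KaehlerM x y : kaehler_rel (d (x * y) - x *: d y - y *: d x)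
| KaehlerC (r : R) : kaehler_rel (d r%:A).

Definition kaehler := quotmod kaehler_rel.
HB.instance Definition _ := GRing.Lmodule.on kaehler.

End Kaehler.

Definition etale (R : comNzRingType) (S : comAlgType R) : Prop :=
  [/\ flat S, finitely_presented S & forall w : kaehler S, w = 0].

Section Intermediate.
Variables (R : comNzRingType) (S : comAlgType R).

Definition subalgebras : set (set S) :=
  [set A | GRing.subalg_closed (mem A)].

Definition FIP : Prop := finite_set subalgebras.

Definition seminormal : Prop :=
  forall b : S, (exists r : R, b ^+ 2 = r%:A) -> (exists r : R, b ^+ 3 = r%:A) ->
    exists r : R, b = r%:A.

(* The R-module S / R. *)
Definition cokernel := quotmod (range (fun r : R => r%:A : S)).
HB.instance Definition _ := GRing.Lmodule.on cokernel.

End Intermediate.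

Arguments subalgebras {R} S _.

Section Localization.
Variables (R : comPzRingType) (E : lmodType R) (U : set R).

(* The multiplicative submonoid generated by U. *)
Definition mclosure : set R :=
  [set u | forall P : set R, GRing.mulr_closed (mem P) -> U `<=` P -> P u].

Lemma mclosure1 : mclosure 1.
Proof. by move=> P [P1 _] _; rewrite inE in P1. Qed.

Lemma mclosureM u v : mclosure u -> mclosure v -> mclosure (u * v).
Proof.
move=> Uu Uv P sP UP; have [_ PM] := sP.
by have := PM u v; rewrite !inE; apply; [apply: Uu | apply: Uv].
Qed.

Definition denom := {u : R | `[< mclosure u >]}.
HB.instance Definition _ := Choice.on denom.

Lemma denomP (u : denom) : mclosure (val u).
Proof. exact/asboolP/(valP u). Qed.

Definition mkdenom u (Uu : mclosure u) : denom := exist _ u (asboolT Uu).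
Definition denom1 : denom := mkdenom mclosure1.
Definition denomM (u v : denom) : denom :=
  mkdenom (mclosureM (denomP u) (denomP v)).

Definition loc_eq (p q : E * denom) : bool :=
  `[< exists u : denom,
        val u *: (val q.2 *: p.1) = val u *: (val p.2 *: q.1) >].

Lemma loc_eq_equiv : equiv_class_of loc_eq.
Proof.
split=> [p|p q|q p r].
- by apply/asboolP; exists denom1.
- by apply/asboolP/asboolP => -[u e]; exists u; rewrite e.
move=> /asboolP [u eu] /asboolP [v ev]; apply/asboolP.
exists (denomM (denomM u v) q.2) => /=; rewrite !scalerA in eu ev *.
have -> : val u * val v * val q.2 * val r.2
        = (val v * val r.2) * (val u * val q.2).
  by rewrite [RHS]mulrC mulrACA mulrA [val u * _ * _]mulrAC.
have -> : val u * val v * val q.2 * val p.2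
        = (val u * val p.2) * (val v * val q.2).
  by rewrite -[_ * _ * val q.2]mulrA mulrAC.
by rewrite -scalerA eu -[in RHS]scalerA -ev !scalerA mulrC.
Qed.

Canonical loc_equiv := EquivRelPack loc_eq_equiv.
Canonical loc_encModRel := defaultEncModRel loc_eq.

(* The localization of E at the submonoid generated by U; E_M is [loc E (~` M)],
   as the complement of a maximal ideal M is a submonoid. *)
Definition loc := {eq_quot loc_eq}.
HB.instance Definition _ := EqQuotient.on loc.
HB.instance Definition _ := Choice.on loc.

Definition frac (x : E) (u : denom) : loc := \pi_loc (x, u).

Lemma frac_eq x u y v :
  frac x u = frac y v <-> exists w : denom,
    val w *: (val v *: x) = val w *: (val u *: y).
Proof.
rewrite /frac; split=> [/eqP|e]; last apply/eqP; rewrite piE /loc_eq.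
  by move/asboolP.
exact/asboolP.
Qed.

Lemma fracP (q : loc) : exists x u, q = frac x u.
Proof.
by exists (repr q).1, (repr q).2; rewrite /frac -surjective_pairing reprK.
Qed.

Definition lzero : loc := frac 0 denom1.
Definition lopp (q : loc) : loc := frac (- (repr q).1) (repr q).2.
Definition ladd (p q : loc) : loc :=
  frac (val (repr q).2 *: (repr p).1 + val (repr p).2 *: (repr q).1)
    (denomM (repr p).2 (repr q).2).

Lemma repr_frac x u : exists w : denom,
  val w *: (val u *: (repr (frac x u)).1)
    = val w *: (val (repr (frac x u)).2 *: x).
Proof.
by apply/frac_eq; rewrite /frac -surjective_pairing reprK.
Qed.

Lemma lopp_frac x u : lopp (frac x u) = frac (- x) u.
Proof.
have [w e] := repr_frac x u; apply/frac_eq; exists w.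
by rewrite !scalerN e.
Qed.

Lemma ladd_frac x u y v :
  ladd (frac x u) (frac y v) = frac (val v *: x + val u *: y) (denomM u v).
Proof.
rewrite /ladd; set p := repr (frac x u); set q := repr (frac y v).
have [w e] := repr_frac x u; have [w' e'] := repr_frac y v.
rewrite -/p -/q in e e'.
apply/frac_eq; exists (denomM w w') => /=; rewrite !scalerDr !scalerA.
rewrite !scalerA in e e'; congr (_ + _).
  have -> : val w * val w' * (val u * val v) * val q.2
      = (val w' * val v * val q.2) * (val w * val u).
    by rewrite mulrACA [RHS]mulrC !mulrA.
  have -> : val w * val w' * (val p.2 * val q.2) * val v
      = (val w' * val v * val q.2) * (val w * val p.2).
    by rewrite mulrACA [RHS]mulrC -!mulrA [val q.2 * val v]mulrC.
  by rewrite -[LHS]scalerA e scalerA.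
have -> : val w * val w' * (val u * val v) * val p.2
    = (val w * val u * val p.2) * (val w' * val v).
  by rewrite [LHS](AC (2*2*1) ((1*3*5)*(2*4))).
have -> : val w * val w' * (val p.2 * val q.2) * val u
    = (val w * val u * val p.2) * (val w' * val q.2).
  by rewrite [LHS](AC (2*2*1) ((1*5*3)*(2*4))).
by rewrite -[LHS]scalerA e' scalerA.
Qed.

Lemma laddA : associative ladd.
Proof.
move=> p q r; have [x [u ->]] := fracP p; have [y [v ->]] := fracP q.
have [z [w ->]] := fracP r; rewrite !ladd_frac; apply/frac_eq; exists denom1.
rewrite /= !scale1r mulrA; congr (_ *: _).
rewrite !scalerDr !scalerA addrA [sval v * sval w]mulrC.
by rewrite [sval u * sval w]mulrC.
Qed.

Lemma laddC : commutative ladd.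
Proof.
move=> p q; have [x [u ->]] := fracP p; have [y [v ->]] := fracP q.
rewrite !ladd_frac; apply/frac_eq; exists denom1.
by rewrite /= !scale1r addrC mulrC.
Qed.

Lemma ladd0 : left_id lzero ladd.
Proof.
move=> p; have [x [u ->]] := fracP p; rewrite ladd_frac.
apply/frac_eq; exists denom1.
by rewrite /= !scale1r scaler0 add0r mul1r.
Qed.

Lemma laddN : left_inverse lzero lopp ladd.
Proof.
move=> p; have [x [u ->]] := fracP p; rewrite lopp_frac ladd_frac.
apply/frac_eq; exists denom1.
by rewrite scalerN addNr !scaler0.
Qed.

HB.instance Definition _ := GRing.isZmodule.Build loc laddA laddC ladd0 laddN.

End Localization.

Definition maximal_ideal (R : comNzRingType) (M : set R) : Prop :=
  idealr_closed (mem M) /\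
  forall J : set R, idealr_closed (mem J) -> M `<=` J -> J = M.

Definition MSupp (R : comNzRingType) (E : lmodType R) : set (set R) :=
  [set M | maximal_ideal M /\ exists q : loc E (~` M), q <> 0].
Arguments MSupp {R} E _.

Definition artinian_ring (R : comNzRingType) : Prop :=
  forall I : nat -> set R^o,
    (forall n, GRing.submod_closed (mem (I n))) ->
    (forall n, I n.+1 `<=` I n) ->
    exists n, forall m, (n <= m)%N -> I m = I n.

Definition reduced_ring (R : comNzRingType) : Prop :=
  forall (x : R) n, x ^+ n = 0 -> x = 0.

Definition bell (n : nat) : nat :=
  #|[set P : {set {set 'I_n}} | finset.partition P [set: 'I_n]]%SET|.

(* Main.v *)
Require Import Defs.
From HB Require Import structures.
From mathcomp Require Import all_boot all_order all_algebra.
From mathcomp Require Import boolp classical_sets functions cardinality fsbigop.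
From mathcomp Require Import freeg mpoly.
Import GRing.Theory.
Local Open Scope ring_scope.
Local Open Scope classical_set_scope.
Local Open Scope card_scope.

Set Implicit Arguments.
Unset Strict Implicit.
Unset Printing Implicit Defensive.

(** An Artinian reduced ring is von Neumann regular and satisfies the descending
    chain condition, so each of its ideals is generated by an idempotent
    ([artinian_reduced_idem]).  This single property replaces the decomposition
    into fields: over such a ring every submodule is a direct summand
    ([submodule_projection]), and every linear map has a generalised inverse
    ([quasi_inverse]); in particular every module is flat.

    Separability gives sum x_i (x) y_i in S (x) S with sum x_i y_i = 1 and
    sum (s x_i) (x) y_i = sum x_i (x) (s y_i) ([separable_casimir]).  With
    linear forms g_j dual to the family x, the identity
    s = sum_(i, j) g_j (s x_i) x_j y_i shows that S is a finite module;
    applied to (x, y) |-> x dy the same element kills the differentials.  It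
    also averages R-linear projections into S-linear ones ([averaging]), so S,
    and then S (x) S, inherit the idempotent property; in particular S is
    reduced, which gives seminormality.

    For the bound, let A be a subalgebra and s an element outside A.  The ring
    A is again Artinian and reduced, hence there is an A-linear projection of
    S onto A, which shows that s (x) 1 - 1 (x) s is not in the ideal of
    S (x) S generated by the a (x) 1 - 1 (x) a.  A residue field of S (x) S
    then provides two morphisms from S to a field which agree on A and differ
    at s ([hom_separation]).  These morphisms lie over a maximal ideal M of R,
    and M is in the support of S/R because they differ.

    For a fixed M, a family of distinct morphisms from S to a field over M has
    at most n_M = dim (S/MS) members, by Dedekind's independence
    ([homs_le_dimension]).  A family of maximal length sees every pair of
    morphisms over M, since two fields over R/M embed in a common one
    ([field_amalgam], [universal_family]).  So A is determined by the
    partitions of its index sets, M ranging over the support: two indices are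
    in the same block when the morphisms agree on A.  Counting the partitions
    gives the product of Bell numbers. *)

(** * Semisimplicity from idempotent generators *)

(** The Prop-valued form of [GRing.submod_closed], easier to use with
    classical sets. For E := R^o these are the ideals of R, the unit ideal
    included. *)
Definition submodule (R : pzRingType) (E : lmodType R) (N : set E) : Prop :=
  N 0 /\ forall a x y, N x -> N y -> N (a *: x + y).

Lemma submoduleP (R : pzRingType) (E : lmodType R) (N : set E) :
  GRing.submod_closed (mem N) <-> submodule N.
Proof.
split=> -[N0 NZD]; split=> [|a x y]; rewrite ?inE // in N0 *.
  by have := NZD a x y; rewrite !inE.
exact: NZD.
Qed.

Section Submodule.
Variables (R : pzRingType) (E : lmodType R) (N : set E).
Hypothesis sN : submodule N.

Lemma submodule0 : N 0. Proof. by case: sN. Qed.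

Lemma submoduleD x y : N x -> N y -> N (x + y).
Proof. by move=> Nx Ny; rewrite -[x]scale1r; apply: sN.2. Qed.

Lemma submoduleZ a x : N x -> N (a *: x).
Proof. by move=> Nx; rewrite -[_ *: _]addr0; apply: sN.2 => //; apply: sN.1. Qed.

Lemma submoduleB x y : N x -> N y -> N (x - y).
Proof. by move=> Nx Ny; rewrite addrC -scaleN1r; apply: sN.2. Qed.

Lemma submodule_sum (I : Type) (r : seq I) (P : pred I) (F : I -> E) :
  (forall i, P i -> N (F i)) -> N (\sum_(i <- r | P i) F i).
Proof.
by move=> NF; elim/big_rec: _ => [|i x Pi Nx];
  [apply: submodule0 | apply: submoduleD => //; apply: NF].
Qed.

End Submodule.

Lemma mspan_submodule (R : pzRingType) (E : lmodType R) (N : set E) :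
  submodule (mspan N).
Proof. by split=> [|a x y]; [apply: mspan0 | apply: mspanZD]. Qed.

Lemma mspan_min (R : pzRingType) (E : lmodType R) (N P : set E) :
  submodule P -> N `<=` P -> mspan N `<=` P.
Proof. by move=> /submoduleP sP; apply: mspan_sub. Qed.

Lemma linear_pack (R : pzRingType) (E F : lmodType R) (f : E -> F) :
  linear f -> exists g : {linear E -> F}, g =1 f.
Proof.
move=> lf; pose g : {linear E -> F} := HB.pack f
  (GRing.isLinear.Build R E F *:%R f lf).
by exists g.
Qed.

(** Such an f is idempotent, and generates I. Rings with this property are the
    finite products of fields, that is, the commutative semisimple rings. *)
Definition idem_ideals (R : comPzRingType) : Prop :=
  forall I : set R^o, submodule I ->
    exists2 f : R, I f & forall x, I x -> x = f * x :> R.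

(** Regularity comes from the chain of the ideals (a^n). If an idempotent f of
    I does not generate I, some x - f x in I is nonzero, and adding to f an
    idempotent generator of the ideal of x - f x gives a larger idempotent of
    I; the annihilators of a sequence of such idempotents would decrease
    strictly. *)
Lemma artinian_reduced_idem (R : comNzRingType) :
  artinian_ring R -> reduced_ring R -> idem_ideals R.
Proof.
move=> artR redR.
have vnr (a : R) : exists b, a = a * b * a.
  have [|n|n an] := artR (fun n => [set x | exists b, x = a ^+ n * b]).
  - move=> n; apply/submoduleP; split=> [|c x y [b ->] [d ->]].
      by exists 0; rewrite mulr0.
    by exists (c * b + d); rewrite mulrDr mulrCA.
  - by move=> x [b ->]; exists (a * b); rewrite mulrA exprSr.
  have [b] : [set x | exists b, x = a ^+ n.+1 * b] (a ^+ n).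
    by rewrite an //; exists 1; rewrite mulr1.
  move=> /= e; exists b; apply/eqP; rewrite -subr_eq0; apply/eqP.
  apply: (redR _ n.+1).
  have -> : a - a * b * a = a * (1 - a * b).
    by rewrite mulrBr mulr1 mulrCA mulrA mulrC mulrA mulrAC [a * b]mulrC.
  have an0 : a ^+ n * (1 - a * b) = 0.
    by rewrite mulrBr mulr1 mulrA -exprSr -e subrr.
  by rewrite exprMn exprSr exprS mulrACA an0 mul0r.
move=> I sI; apply: contrapT => noI.
have step (f : R) : exists f' : R, (I f /\ f * f = f) ->
    [/\ I f', f' * f' = f', f * f' = f & f' != f].
  have [[If ff]|] := pselect (I f /\ f * f = f); last by exists 0.
  have /existsNP[x /not_implyP[Ix /eqP xf]] : ~ forall x, I x -> x = f * x :> R.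
    by move=> h; apply: noI; exists f.
  pose y := (1 - f) * x; have [b yb] := vnr y.
  have fy : f * y = 0 by rewrite /y mulrA mulrBr mulr1 ff subrr mul0r.
  have yn0 : y != 0 by rewrite /y mulrBl mul1r subr_eq0.
  have Iy : I y.
    rewrite /y mulrBl mul1r; apply: (submoduleB sI) => //.
    exact: (submoduleZ sI f).
  have fg : f * (y * b) = 0 by rewrite mulrA fy mul0r.
  have gg : y * b * (y * b) = y * b by rewrite mulrA -yb.
  exists (f + y * b) => _; split.
  - by apply: (submoduleD sI) => //; rewrite mulrC; apply: (submoduleZ sI b).
  - by rewrite mulrDl !mulrDr ff fg gg [_ * f]mulrC fg add0r addr0.
  - by rewrite mulrDr ff fg addr0.
  - by apply/eqP => /(congr1 (+%R^~ (- f))); rewrite addrAC subrr add0r => g0;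
      move/eqP: yn0; apply; rewrite yb g0 mul0r.
have [next nextP] := choice step.
pose F n := iter n next 0.
have FP n : I (F n) /\ F n * F n = F n.
  elim: n => [|n IH]; first by rewrite mulr0; split=> //; apply: sI.1.
  by have [? ? _ _] := nextP _ IH.
have FS n := nextP _ (FP n).
have [|n|n stab] := artR (fun n => [set x | x * F n = 0]).
- move=> n; apply/submoduleP; split=> [|c x y /= xF yF]; first exact: mul0r.
  by rewrite mulrDl -[c *: x]/(c * x) -mulrA xF yF mulr0 addr0.
- move=> x /= xF; have [_ _ <- _] := FS n; rewrite mulrCA -/(F n.+1) xF.
  by rewrite mulr0.
have : [set x | x * F n.+1 = 0] (1 - F n).
  by rewrite stab //= mulrBl mul1r (FP n).2 subrr.
have [_ _ fF /eqP ne] := FS n; rewrite -/(F n.+1) in fF ne.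
by rewrite /= mulrBl mul1r fF => /eqP; rewrite subr_eq0 => /eqP.
Qed.

Section Semisimple.
Variable R : comPzRingType.
Hypothesis idR : idem_ideals R.

Lemma idem_vnr (a : R) : exists b, a = a * b * a.
Proof.
have [|f [b ->] fP] := idR (I := [set x | exists b, x = b * a]).
  split=> [|c x y [b ->] [d ->]]; first by exists 0; rewrite mul0r.
  by exists (c * b + d); rewrite mulrDl -[c *: _]/(c * _) mulrA.
exists b; rewrite [a * b]mulrC; apply: fP; by exists 1; rewrite mul1r.
Qed.

(** Zorn's lemma gives a maximal W meeting N trivially. For any x, let f
    generate the ideal of the scalars c such that c x is in N + W: then W + R
    (x - f x) still meets N trivially, so x - f x is in W and x is in N + W.
    *)
Lemma submodule_projection (E : lmodType R) (N : set E) : submodule N ->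
  exists p : {linear E -> E}, (forall x, N (p x)) /\ forall x, N x -> p x = x.
Proof.
move=> sN.
(* The union with {0} lets P hold of the union of the empty chain. *)
pose P (W : set E) := submodule (W `|` [set 0]) /\ forall x, W x -> N x -> x = 0.
have [|W [[sW WN] maxW]] := @Zorn_bigcup E P.
  move=> F FP totF; split=> [|x [W FW Wx]]; last exact: (FP W FW).2.
  split=> [|a x y]; first by right.
  have one W z c : F W -> W z -> (\bigcup_(X in F) X `|` [set 0]) (c *: z).
    move=> FW Wz; have := submoduleZ (FP _ FW).1 c (or_introl Wz : (W `|` [set 0]) z).
    by case=> [Wcz|->]; [left; exists W | right].
  case=> [[X FX Xx]|->]; last by rewrite scaler0 add0r.
  case=> [[Y FY Yy]|->]; last by rewrite addr0; apply: one Xx.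
  have [Z [FZ Zx Zy]] : exists Z, [/\ F Z, Z x & Z y].
    by case: (totF _ _ FX FY) => s; [exists Y | exists X]; split => //; apply: s.
  by case: ((FP _ FZ).1.2 a x y (or_introl Zx) (or_introl Zy)) => [Zc|->];
    [left; exists Z | right].
pose V := W `|` [set 0].
have VN x : V x -> N x -> x = 0 by case=> [|->//]; apply: WN.
have maxV x : (forall c z, V z -> N (z + c *: x) -> z + c *: x = 0) -> V x.
  move=> xP; apply: contrapT => nVx.
  pose U := [set u | exists c z, V z /\ u = z + c *: x].
  have U0 : U 0 by exists 0, 0; split; [apply: sW.1 | rewrite scale0r addr0].
  have WU : W `<=` U.
    by move=> w Ww; exists 0, w; split; [left | rewrite scale0r addr0].
  apply: (maxW U).
    split=> // /(_ x) UW; apply: nVx; left; apply: UW.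
    by exists 1, 0; split; [apply: sW.1 | rewrite scale1r add0r].
  split=> [|_ [c [z [Vz ->]]]]; last exact: xP.
  split=> [|a u v]; first by right.
  have UU w : (U `|` [set 0]) w -> U w by case=> [|->].
  move=> /UU [c [z [Vz ->]]] /UU [d [t [Vt ->]]]; left.
  exists (a * c + d), (a *: z + t); split; first exact: sW.2.
  by rewrite scalerDr scalerDl scalerA addrACA.
have dec x : exists n, N n /\ V (x - n).
  pose I : set R^o := [set c : R | exists n, N n /\ V ((c : R) *: x - n)].
  have [|f [n [Nn Vn]] fP] := idR (I := I).
    split=> [|c u v [n [Nn Vn]] [m [Nm Vm]]].
      by exists 0; rewrite scale0r subrr; split; [apply: sN.1 | apply: sW.1].
    exists (c *: n + m); split; first exact: sN.2.
    have -> : (c *: u + v) *: x - (c *: n + m)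
            = c *: (u *: x - n) + (v *: x - m).
      by rewrite scalerDl -[c *: u]/(c * u) -scalerA scalerBr opprD addrACA.
    exact: sW.2.
  have Vy : V (x - f *: x).
    apply: maxV => c z Vz; set y := z + _ => Ny.
    have cf : (c * (1 - f)) *: x = y - z.
      rewrite /y [z + _]addrC addrK -scalerA scalerBl scale1r //.
    have Ic : I (c * (1 - f)).
      exists y; split=> //; rewrite cf addrAC subrr add0r -scaleN1r.
      exact: (submoduleZ sW).
    have ff : f * f = f by rewrite -fP //; exists n.
    have c0 : c * (1 - f) = 0.
      by rewrite (fP _ Ic) mulrCA mulrBr mulr1 ff subrr mulr0.
    have yz : y = z by apply/eqP; rewrite -subr_eq0 -cf c0 scale0r.
    by apply: VN => //; rewrite yz.
  exists n; split=> //.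
  by rewrite -[x](subrK (f *: x)) -addrA; apply: (submoduleD sW).
have [p pP] := choice dec.
have uniq x n : N n -> V (x - n) -> p x = n.
  move=> Nn Vn; have [Np Vp] := pP x; apply/eqP; rewrite -subr_eq0; apply/eqP.
  apply: VN; last exact: submoduleB.
  have -> : p x - n = (x - n) - (x - p x).
    by rewrite opprB [RHS]addrC addrA subrK.
  exact: submoduleB.
have [|q qE] := @linear_pack _ _ _ p.
  move=> a x y; have [Nx Vx] := pP x; have [Ny Vy] := pP y.
  apply: uniq; first exact: sN.2.
  by rewrite opprD addrACA -scalerBr; apply: sW.2.
exists q; split=> x; rewrite qE; first by have [] := pP x.
by move=> Nx; apply: uniq => //; rewrite subrr; apply: sW.1.
Qed.

(** Both the kernel and the range of h are direct summands. For an injective h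
    this is a retraction, for a surjective h a section. *)
Lemma quasi_inverse (E F : lmodType R) (h : {linear E -> F}) :
  exists k : {linear F -> E}, forall x, h (k (h x)) = h x.
Proof.
have [|q [qN qid]] := submodule_projection (N := [set x | h x = 0]).
  split=> [|a x y /= hx hy]; first exact: linear0.
  by rewrite linearP /= hx hy scaler0 addr0.
have [|p [pN pid]] := submodule_projection (N := range h).
  split=> [|a _ _ [x _ <-] [y _ <-]]; first by exists 0; rewrite ?linear0.
  by exists (a *: x + y); rewrite ?linearP.
have /choice[g gP] y : exists x, h x = p y by have [x _ <-] := pN y; exists x.
have hq x : h (x - q x) = h x by rewrite linearB /= [h (q x)]qN subr0.
have dq x x' : h x = h x' -> x - q x = x' - q x'.
  move=> e; have : q (x - x') = x - x' by apply: qid; rewrite /= linearB /= e subrr.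
  rewrite linearB /= => e'; rewrite -{1}[x](subrK x') -e' addrAC.
  by rewrite [q x - _ - _]addrAC subrr add0r addrC.
have [|k kE] := @linear_pack _ _ _ (fun y => g y - q (g y)).
  move=> a x y; rewrite (dq _ (a *: g x + g y)).
    by rewrite linearP /= opprD addrACA -scalerBr.
  by rewrite linearP !gP linearP.
exists k => x; rewrite kE hq gP pid //; by exists x.
Qed.

End Semisimple.

(** * The separability idempotent and étale algebras *)

Lemma tensor_sum (R : comNzRingType) (M N : lmodType R) (t : tensor M N) :
  exists n (x : 'I_n -> M) (y : 'I_n -> N), t = \sum_i tens (x i) (y i).
Proof.
have [s ->] : exists s : seq (M * N), t = \sum_(z <- s) tens z.1 z.2.
  elim/tens_ind: t => [|x y t [s ->]]; first by exists [::]; rewrite big_nil.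
  by exists ((x, y) :: s); rewrite big_cons.
exists (size s), (fun i => (tnth (in_tuple s) i).1), (fun i => (tnth (in_tuple s) i).2).
by rewrite big_tnth.
Qed.

Lemma tlift_sum (R : comNzRingType) (M N P : lmodType R) (f : M -> N -> P) n
    (x : 'I_n -> M) (y : 'I_n -> N) : bilinear_map f ->
  tlift f (\sum_i tens (x i) (y i)) = \sum_i f (x i) (y i).
Proof.
move=> fb; have [F FE] := linear_pack (tlift_linear fb).
by rewrite -FE linear_sum; apply: eq_bigr => i _; rewrite /= FE tliftE.
Qed.

(** The coordinates of a separability idempotent of S over R. *)
Definition casimir (R : comNzRingType) (S : comAlgType R) n (x y : 'I_n -> S) :=
  \sum_i x i * y i = 1 /\
  forall s, \sum_i tens (s * x i) (y i) = \sum_i tens (x i) (s * y i) :> tensor S S.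

(** Projectivity lifts the identity of S along the multiplication map; the
    lift of 1 is the element wanted, since both s (x) 1 and 1 (x) s act on S
    as s. *)
Lemma separable_casimir (R : comNzRingType) (S : comAlgType R) :
  separable_algebra S -> exists n (x y : 'I_n -> S), casimir x y.
Proof.
move=> sepS; pose T := talg S.
have [|p pE] := @linear_pack T T^o (restr (@tprod R S)) (@tprod R S).
  by move=> a x y; rewrite rmorphD rmorphM.
have [|h hE] := @linear_pack T (restr (@tprod R S)) (restr (@tprod R S)) id.
  by [].
have [|l lP] := sepS _ _ p h.
  move=> b; exists (tens (b : S) (1 : S)); rewrite pE; apply: etrans (tprodE _ _) _.
  exact: mulr1.
have lZ (t : T) : (t : T) * l (1 : S) = l (tprod t : S).
  apply: etrans (esym (linearZ_LR l t (1 : S))) _; congr (l _).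
  exact: mulr1.
have [n [x [y e]]] := tensor_sum (l (1 : S)).
exists n, x, y; split=> [|s].
  have := lP (1 : S); rewrite hE pE => <-.
  rewrite e rmorph_sum; apply: eq_bigr => i _; exact/esym/tprodE.
have := lZ (tens s 1); have := lZ (tens 1 s).
rewrite !tprodE mulr1 mul1r => <-; rewrite e !mulr_sumr => E.
have {}E : \sum_i tmul (tens s 1) (tens (x i) (y i))
  = \sum_i tmul (tens 1 s) (tens (x i) (y i)) := E.
have E1 : \sum_i tmul (tens s 1) (tens (x i) (y i)) = \sum_i tens (s * x i) (y i).
  by apply: eq_bigr => i _; rewrite tmulE mul1r.
have E2 : \sum_i tmul (tens 1 s) (tens (x i) (y i)) = \sum_i tens (x i) (s * y i).
  by apply: eq_bigr => i _; rewrite tmulE mul1r.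
by rewrite -E1 E E2.
Qed.

Lemma casimir_bilinear (R : comNzRingType) (S : comAlgType R) n (x y : 'I_n -> S)
    (P : lmodType R) (f : S -> S -> P) : casimir x y -> bilinear_map f ->
  forall s, \sum_i f (s * x i) (y i) = \sum_i f (x i) (s * y i).
Proof.
move=> [_ xy] fb s.
by rewrite -(tlift_sum _ y fb) -(tlift_sum x _ fb) xy.
Qed.

(** The forms k _ j restrict to a dual basis of the span of x, although x need
    not be free; k is a generalised inverse of the map sending coefficients to
    combinations of x. *)
Lemma dual_family (R : comPzRingType) (E : lmodType R) n (x : 'I_n -> E) :
  idem_ideals R -> exists k : {linear E -> {ffun 'I_n -> R^o}},
    forall c : 'I_n -> R, \sum_j k (\sum_i c i *: x i) j *: x j = \sum_i c i *: x i.
Proof.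
move=> idR.
have [|h hE] := @linear_pack R {ffun 'I_n -> R^o} E (fun c => \sum_i (c i : R) *: x i).
  move=> a u v; rewrite scaler_sumr -big_split; apply: eq_bigr => i _ /=.
  by rewrite !ffunE scalerDl scalerA.
have [k kP] := quasi_inverse idR h; exists k => c.
have := kP [ffun i => c i : R^o]; rewrite !hE.
under [X in k X]eq_bigr do rewrite ffunE.
by move=> ->; apply: eq_bigr => i _; rewrite ffunE.
Qed.

Definition spanning (R : pzRingType) (E : lmodType R) n (z : 'I_n -> E) : Prop :=
  forall u, exists c : 'I_n -> R, u = \sum_i c i *: z i.

Lemma spanning_image (R : pzRingType) (I : finType) (E : lmodType R) (z : I -> E) :
  (forall u, exists c : I -> R, u = \sum_i c i *: z i) ->
  exists n (w : 'I_n -> E), spanning w.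
Proof.
move=> zP; exists #|I|, (fun k => z (enum_val k)) => u; have [c ->] := zP u.
exists (fun k => c (enum_val k)).
by rewrite (reindex (@enum_val I I)) //; apply: onW_bij; apply: enum_val_bij.
Qed.

(** With forms k _ j dual to the family x, the Casimir identity applied to (u,
    v) |-> k u j *: v moves s to the coefficients, and gives s = sum_(i, j) k
    (s x_i) j *: (x_j y_i). *)
Lemma separable_spanning (R : comNzRingType) (S : comAlgType R) :
  idem_ideals R -> separable_algebra S -> exists n (z : 'I_n -> S), spanning z.
Proof.
move=> idR /separable_casimir[n [x [y xy]]].
have [k kP] := dual_family x idR.
apply: (spanning_image (z := fun p : 'I_n * 'I_n => x p.2 * y p.1)) => s.
have kx i : \sum_j k (x i) j *: x j = x i.
  have <- : \sum_j (j == i)%:R *: x j = x i; last exact: kP.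
  rewrite (bigD1 i) //= eqxx scale1r big1 ?addr0 // => j /negPf ->.
  exact: scale0r.
exists (fun p => k (s * x p.1) p.2).
rewrite -(pair_bigA _ (fun i j => k (s * x i) j *: (x j * y i))) /=.
rewrite exchange_big /=.
rewrite -[LHS]mulr1 -xy.1 mulr_sumr.
transitivity (\sum_j x j * \sum_i k (s * x i) j *: y i); last first.
  apply: eq_bigr => j _; rewrite mulr_sumr; apply: eq_bigr => i _.
  by rewrite scalerAr.
transitivity (\sum_j x j * \sum_i k (x i) j *: (s * y i)).
  transitivity (\sum_i \sum_j x j * (k (x i) j *: (s * y i))).
    apply: eq_bigr => i _; rewrite -{1}[x i]kx mulr_suml mulr_sumr.
    by apply: eq_bigr => j _; rewrite -scalerAl -!scalerAr mulrCA.
  by rewrite exchange_big /=; apply: eq_bigr => j _; rewrite mulr_sumr.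
apply: eq_bigr => j _; congr (_ * _); apply/esym.
apply: (casimir_bilinear (f := fun u v => k u j *: v)) => //.
split=> [v|u] a b c; last by rewrite scalerDr !scalerA mulrC.
by rewrite linearP !ffunE scalerDl scalerA.
Qed.

Lemma spanning_module_finite (R : pzRingType) (E : lmodType R) n (z : 'I_n -> E) :
  spanning z -> module_finite E.
Proof.
move=> zP; exists [seq z i | i <- enum 'I_n]; apply/seteqP; split=> // u _.
have [c ->] := zP u; apply: (submodule_sum (mspan_submodule _)) => i _.
apply: (submoduleZ (mspan_submodule _)); apply: sub_mspan => /=.
by apply: map_f; rewrite mem_enum.
Qed.

(** An injective map has a linear retraction, which survives tensoring. *)
Lemma idem_flat (R : comNzRingType) (E : lmodType R) : idem_ideals R -> flat E.
Proof.
move=> idR M N h hinj; have [k kP] := quasi_inverse idR h.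
have kh x : k (h x) = x by apply: hinj.
have tb (P Q : lmodType R) (g : {linear P -> Q}) :
    exists G : {linear tensor E P -> tensor E Q}, G =1 tmap g.
  apply: linear_pack; apply: tlift_linear.
  split=> [{}y|{}x] a u v; first by rewrite tensDl tensZl.
  by rewrite linearP tensDr tensZr.
have [H HE] := tb _ _ h; have [K KE] := tb _ _ k.
apply: (can_inj (g := K)) => t; rewrite -HE.
elim/tens_ind: t => [|x y t IH]; first by rewrite !linear0.
by rewrite !linearD IH /= HE KE !tmapE kh.
Qed.

(** Restriction of scalars, needed to see a module over S as the target of an
    R-bilinear map. *)
Definition resmod (R S : pzRingType) (g : {rmorphism R -> S}) (E : lmodType S) :
  Type := E.

Section ResMod.
Variables (R S : pzRingType) (g : {rmorphism R -> S}) (E : lmodType S).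
HB.instance Definition _ := GRing.Zmodule.on (resmod g E).
Definition resscale (r : R) (x : resmod g E) : resmod g E := g r *: (x : E).
Lemma resscaleA a b x : resscale a (resscale b x) = resscale (a * b) x.
Proof. by rewrite /resscale scalerA rmorphM. Qed.
Lemma resscale1 : left_id 1 resscale.
Proof. by move=> x; rewrite /resscale rmorph1 scale1r. Qed.
Lemma resscaleDr : right_distributive resscale +%R.
Proof. by move=> a x y; apply: scalerDr. Qed.
Lemma resscaleDl x : {morph resscale^~ x : a b / a + b}.
Proof. by move=> a b; rewrite /resscale rmorphD; apply: scalerDl. Qed.
HB.instance Definition _ := GRing.Zmodule_isLmodule.Build R (resmod g E)
  resscaleA resscale1 resscaleDr resscaleDl.
End ResMod.

(** Applied to (u, v) |-> u dv, the Casimir identity reads sum s x_i dy_i =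
    sum x_i d(s y_i), and by the Leibniz rule the right-hand side exceeds the
    left one by (sum x_i y_i) ds = ds. *)
Lemma casimir_kaehler0 (R : comNzRingType) (S : comAlgType R) n (x y : 'I_n -> S) :
  casimir x y -> forall w : kaehler S, w = 0.
Proof.
move=> xy; pose K := quotmod (@kaehler_rel R S).
pose d (s : S) : K := qpi (@kaehler_rel R S) << s >>.
have dD u v : d (u + v) = d u + d v.
  rewrite /d -qpiD; apply/qpi_eq; apply: sub_mspan; rewrite opprD addrA.
  exact: KaehlerD.
have dM u v : d (u * v) = u *: d v + v *: d u.
  rewrite /d -!linearZ -qpiD; apply/qpi_eq; apply: sub_mspan; rewrite opprD addrA.
  exact: KaehlerM.
have dZ (c : R) u : d (c *: u) = c%:A *: d u.
  have -> : c *: u = c%:A * u by rewrite mulr_algl.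
  rewrite dM; have -> : d c%:A = 0.
    by apply/qpi_eq0; apply: sub_mspan; apply: KaehlerC.
  by rewrite scaler0 addr0.
have d0 s : d s = 0.
  have fb : bilinear_map (fun u v : S => u *: d v : resmod (GRing.in_alg S) K).
    split=> [v|u] a p q; first by rewrite scalerDl -mulr_algl -scalerA.
    by rewrite dD dZ scalerDr !scalerA mulrC -scalerA.
  have := casimir_bilinear xy fb s.
  rewrite -[LHS]add0r.
  have -> : \sum_i (x i *: d (s * y i) : K) = d s + \sum_i (s * x i) *: d (y i).
    rewrite -[d s]scale1r -xy.1 scaler_suml -big_split; apply: eq_bigr => i _ /=.
    by rewrite dM scalerDr addrC !scalerA [s * _]mulrC.
  by move=> /addIr.
move=> w; rewrite -[w]qreprK -[qrepr w]freeg_sumE linear_sum big1 // => s _.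
have := d0 s; rewrite /d => e.
have -> : << coeff s (qrepr w) *g s >> = coeff s (qrepr w) *: << s >> :> {freeg S / S}.
  by apply/eqP/freeg_eqP => z; rewrite coeffZ !coeffU mul1r.
by rewrite linearZ /= e scaler0.
Qed.

(** For a projection p of B onto the ideal J that is only C-linear, t |-> sum
    X_k p (Y_k t) is B-linear by the second hypothesis, and still a projection
    onto J by the first; its value at 1 generates J. *)
Lemma averaging (C B : comPzRingType) (i : {rmorphism C -> B}) n (X Y : 'I_n -> B) :
  \sum_k X k * Y k = 1 ->
  (forall (p : {linear restr i -> restr i}) (b t : B),
     b * \sum_k X k * p (Y k * t) = \sum_k X k * p (Y k * (b * t))) ->
  idem_ideals C -> idem_ideals B.
Proof.
move=> XY pP idC J sJ.
have [|p [pJ pid]] := submodule_projection idC (E := restr i) (N := J).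
  split=> [|a x y Jx Jy]; first exact: sJ.1.
  exact: (sJ.2 (i a)).
exists (\sum_k X k * p (Y k * 1)).
  by apply: (submodule_sum sJ) => k _; apply: (submoduleZ sJ).
move=> x Jx; rewrite mulrC pP -{1}[x]mul1r -{1}XY mulr_suml.
apply: eq_bigr => k _; rewrite mulr1 pid ?mulrA //.
exact: (submoduleZ sJ).
Qed.

Lemma separable_idem (R : comNzRingType) (S : comAlgType R) :
  separable_algebra S -> idem_ideals R -> idem_ideals S.
Proof.
move=> /separable_casimir[n [x [y xy]]].
apply: (averaging (i := GRing.in_alg S) xy.1) => p b t.
rewrite mulr_sumr; under eq_bigr do rewrite mulrA.
under [RHS]eq_bigr do rewrite mulrCA mulrA.
apply: (casimir_bilinear (f := fun u v => u * (p (v * t) : S))) => //.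
split=> [v|u] c a d; first by rewrite mulrDl -scalerAl.
have -> : (c *: a + d) * t = (c%:A * (a * t)) + d * t.
  by rewrite mulrDl mulr_algl scalerAl.
have -> : p (c%:A * (a * t) + d * t) = c%:A * (p (a * t) : S) + (p (d * t) : S).
  by have := linearP p c (a * t : S) (d * t : S).
by rewrite mulrDr mulr_algl scalerAr.
Qed.

Section TensorFactors.
Variables (R : comNzRingType) (S : comAlgType R).
Definition tleft (s : S) : talg S := tens s 1.
Lemma tleft_zmod : zmod_morphism tleft.
Proof.
by move=> a b; rewrite /tleft tensDl -scaleN1r tensZl scaleN1r.
Qed.
Lemma tleft_monoid : monoid_morphism tleft.
Proof. by split=> // a b; rewrite [RHS]tmulE mul1r. Qed.
HB.instance Definition _ := GRing.isZmodMorphism.Build S (talg S) tleft tleft_zmod.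
HB.instance Definition _ :=
  GRing.isMonoidMorphism.Build S (talg S) tleft tleft_monoid.
Definition tright (s : S) : talg S := tens 1 s.
Lemma tright_zmod : zmod_morphism tright.
Proof.
by move=> a b; rewrite /tright tensDr -scaleN1r tensZr scaleN1r.
Qed.
Lemma tright_monoid : monoid_morphism tright.
Proof. by split=> // a b; rewrite [RHS]tmulE mul1r. Qed.
HB.instance Definition _ := GRing.isZmodMorphism.Build S (talg S) tright tright_zmod.
HB.instance Definition _ :=
  GRing.isMonoidMorphism.Build S (talg S) tright tright_monoid.

Lemma tens_left_right (a b : S) : tens a b = tleft a * tright b :> talg S.
Proof. by rewrite [RHS]tmulE mulr1 mul1r. Qed.

Lemma talg_scale_left c (t : talg S) : c *: t = tleft c%:A * t.
Proof.
elim/tens_ind: t => [|x y t IH]; first by rewrite scaler0 mulr0.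
rewrite scalerDr mulrDr IH; congr (_ + _).
by apply/esym/(etrans (tmulE _ _ _ _)); rewrite mulr_algl mul1r tensZl.
Qed.

Lemma tright_scale c (a : S) : tright (c *: a) = tleft c%:A * tright a.
Proof. by rewrite -talg_scale_left /tright tensZr. Qed.

(** S (x) S is separable over its left factor, with the Casimir element
    carried by the right factor. *)
Lemma separable_talg_idem :
  separable_algebra S -> idem_ideals R -> idem_ideals (talg S).
Proof.
move=> sepS /(separable_idem sepS).
have [n [x [y xy]]] := separable_casimir sepS.
apply: (averaging (i := tleft) (X := fun i => tright (x i))
  (Y := fun i => tright (y i))).
  under eq_bigr do rewrite -rmorphM.
  by rewrite -rmorph_sum xy.1 rmorph1.
move=> p b.
have pl (s : S) (t : talg S) : p (tleft s * t) = tleft s * (p t : talg S).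
  exact: (linearZ_LR p s t).
have pD (s t : talg S) : p (s + t) = (p s : talg S) + p t by apply: linearD.
elim/tens_ind: b => [|u v b IH] t.
  rewrite mul0r big1 // => k _; rewrite mul0r mulr0.
  by rewrite [p 0]linear0 mulr0.
rewrite mulrDl IH => {IH}.
under [RHS]eq_bigr do rewrite mulrDl mulrDr pD mulrDr.
rewrite [RHS]big_split; congr (_ + _) => /=.
rewrite tens_left_right -mulrA mulr_sumr.
under [RHS]eq_bigr do rewrite -mulrA mulrCA pl mulrCA.
rewrite -[RHS]mulr_sumr; congr (_ * _).
under eq_bigr do rewrite mulrA -rmorphM.
under [RHS]eq_bigr do rewrite mulrCA mulrA -rmorphM.
apply: (casimir_bilinear
  (f := fun v w => tright v * (p (tright w * t) : talg S))) => //.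
split=> [w|w] c a d.
  by rewrite talg_scale_left [tright (_ + _)]rmorphD mulrDl /= tright_scale mulrA.
rewrite talg_scale_left [tright (_ + _)]rmorphD mulrDl /= tright_scale pD.
by rewrite -mulrA pl mulrDr mulrCA.
Qed.
End TensorFactors.

(** * Finite presentation and seminormality *)

Section Evaluation.
Variables (R : comNzRingType) (S : comAlgType R) (n : nat) (z : 'I_n -> S).

Definition mpoly_alg : {mpoly R[n]} -> S := mmap (GRing.in_alg S) z.

Lemma mpoly_alg_scalable : scalable mpoly_alg.
Proof. by move=> c p; rewrite /mpoly_alg mmapZ mulr_algl. Qed.

HB.instance Definition _ :=
  GRing.RMorphism.copy mpoly_alg (mmap (GRing.in_alg S) z).
HB.instance Definition _ :=
  GRing.isScalable.Build R {mpoly R[n]} S *:%R mpoly_alg mpoly_alg_scalable.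

Lemma mpoly_algX i : mpoly_alg 'X_i = z i.
Proof. by rewrite /mpoly_alg mmapX mmap1U. Qed.

End Evaluation.

(** Let L be a linear section of the evaluation at z with values in the linear
    polynomials. The relations 1 = L 1 and X_i X_j = L (z_i z_j) suffice:
    modulo them every polynomial p is congruent to L (p(z)), which is 0 when p
    is in the kernel. *)
Lemma spanning_finitely_presented (R : comNzRingType) (S : comAlgType R) n
    (z : 'I_n -> S) : idem_ideals R -> spanning z -> finitely_presented S.
Proof.
move=> idR zP; exists n, (mpoly_alg z : {lrmorphism _ -> _}).
have [k kP] := dual_family z idR.
have {}kP s : \sum_j k s j *: z j = s by have [c ->] := zP s; apply: kP.
have [|L LE] := @linear_pack R S {mpoly R[n]} (fun s => \sum_j (k s j : R) *: 'X_j).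
  move=> a u v; rewrite scaler_sumr -big_split; apply: eq_bigr => i _ /=.
  by rewrite linearP !ffunE scalerDl scalerA.
have zL s : mpoly_alg z (L s) = s.
  rewrite -[RHS]kP LE linear_sum; apply: eq_bigr => j _.
  by rewrite linearZ /= mpoly_algX.
split=> [s|]; first by exists (L s); exact: zL.
exists (1 - L 1 :: [seq 'X_i * 'X_j - L (z i * z j) | i <- enum 'I_n, j <- enum 'I_n]).
set s := _ :: _; set I := mspan _.
have sI : submodule I := mspan_submodule _.
have I1 : I (1 - L 1).
  by apply: sub_mspan; rewrite /= /s mem_head.
have IX i j : I ('X_i * 'X_j - L (z i * z j)).
  apply: sub_mspan; rewrite /= /s in_cons; apply/orP; right.
  by apply: allpairs_f; rewrite mem_enum.
have red p : I (p - L (mpoly_alg z p)).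
  elim/mpolyind: p => [|c m p _ _ IH].
    by rewrite raddf0 linear0 subr0; exact: (submodule0 sI).
  rewrite linearP linearP /= opprD addrACA; apply: (submoduleD sI) => //.
  rewrite -scalerBr -mul_mpolyC; apply: (submoduleZ sI).
  have XI i q : I (q - L (mpoly_alg z q)) -> I ('X_i * q - L (mpoly_alg z ('X_i * q))).
    move=> Iq; rewrite rmorphM /= mpoly_algX; set w := mpoly_alg z q in Iq *.
    have -> : 'X_i * q - L (z i * w) = 'X_i * (q - L w) + ('X_i * L w - L (z i * w)).
      by rewrite mulrBr addrA subrK.
    apply: (submoduleD sI); first exact: (submoduleZ sI).
    rewrite -[in z i * w](kP w) LE !mulr_sumr (linear_sum L) -sumrB.
    apply: (submodule_sum sI) => j _.
    rewrite -!scalerAr linearZ -scalerBr -mul_mpolyC; exact: (submoduleZ sI).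
  rewrite mpolyXE_id.
  elim/big_rec: _ => [|i q _ Iq]; first by rewrite rmorph1.
  elim: (m i) => [|d IHd]; first by rewrite expr0 mul1r.
  by rewrite exprS -mulrA; apply: XI.
apply/seteqP; split=> p /= => [p0|].
  by have := red p; rewrite p0 linear0 subr0.
have sK : submodule ([set q | mpoly_alg z q = 0] : set {mpoly R[n]}^o).
  split=> [|c p' q /= p0 q0]; first exact: raddf0.
  by rewrite raddfD [X in X + _](rmorphM (mpoly_alg z) c p') /= p0 q0 mulr0 addr0.
apply: (mspan_min sK) => {}p.
rewrite /= /s in_cons => /orP[/eqP ->|/allpairsP[[i j] [_ _ ->]]] /=.
  by rewrite raddfB /= rmorph1 zL subrr.
by rewrite raddfB /= rmorphM /= !mpoly_algX zL subrr.
Qed.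

Lemma idem_reduced (R : comNzRingType) : idem_ideals R -> reduced_ring R.
Proof.
move=> idR x; elim=> [|n IH].
  by rewrite expr0 => /eqP; rewrite oner_eq0.
have [b xb] := idem_vnr idR x; case: n IH => [|n] IH xn.
  by rewrite expr1 in xn.
apply: IH; rewrite exprS {1}xb [x * b]mulrC -!mulrA -!exprS.
by rewrite xn mulr0.
Qed.

(** If b^2 = r and b^3 = t with r = r u r, the element (r u) b = u t is in R,
    and b - (r u) b has square zero. *)
Lemma idem_seminormal (R : comNzRingType) (S : comAlgType R) :
  idem_ideals R -> reduced_ring S -> seminormal S.
Proof.
move=> idR redS b [r br] [t bt].
have [u ru] := idem_vnr idR r.
exists (u * t); have -> : (u * t)%:A = (r * u) *: b.
  by rewrite -scalerA -bt exprS br -scalerAr mulr1 scalerA mulrC.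
apply/eqP; rewrite -subr_eq0 -[b in b - _]scale1r -scalerBl; apply/eqP.
apply: (redS _ 2%N); rewrite exprZn br scalerA expr2 -mulrA.
by rewrite [_ * r]mulrBl mul1r -ru subrr mulr0 scale0r.
Qed.

(** * Subalgebras of S *)

(** Composing projections onto the I k gives projections r k onto I k whose
    kernels increase. The union of the kernels is a direct summand, hence
    finitely generated, so the kernels stabilise, and then so do the images.
    *)
Lemma idem_dcc (R : comPzRingType) (E : lmodType R) n (z : 'I_n -> E)
    (I : nat -> set E) :
  idem_ideals R -> spanning z -> (forall k, submodule (I k)) ->
  (forall k, I k.+1 `<=` I k) -> exists k, forall m, (k <= m)%N -> I m = I k.
Proof.
move=> idR zP sI decI.
have /choice[p pP] k : exists p : {linear E -> E}, (forall x, I k (p x)) /\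
    forall x, I k x -> p x = x by apply: submodule_projection.
pose fix r k : E -> E := if k is k'.+1 then p k \o r k' else p 0.
have rlin k : linear (r k).
  elim: k => [|k IH] a x y /=; first exact: linearP.
  by rewrite IH linearP.
have rI k x : I k (r k x) by case: k => [|k]; apply: (pP _).1.
have rid k x : I k x -> r k x = x.
  elim: k x => [|k IH] x Ix; first exact: (pP _).2.
  by rewrite /= IH; [apply: (pP _).2 | apply: decI].
have rB k x y : r k (x - y) = r k x - r k y.
  by have [g gE] := linear_pack (rlin k); rewrite -!gE linearB.
pose U := [set x | exists k, r k x = 0].
have upK k m x : (k <= m)%N -> r k x = 0 -> r m x = 0.
  move=> /subnK <-; elim: (m - k)%N => [//|d IH] rx.
  by rewrite addSn /= IH // linear0.
have sU : submodule U.
  split=> [|a x y [k rx] [m ry]].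
    by exists 0%N; apply: linear0.
  exists (maxn k m); rewrite rlin (upK k) ?leq_maxl // (upK m) ?leq_maxr //.
  by rewrite scaler0 addr0.
have [q [qU qid]] := submodule_projection idR sU.
have /choice[d dP] i : exists k, r k (q (z i)) = 0 by exact: qU.
have UK x k : (\max_i d i <= k)%N -> U x -> r k x = 0.
  move=> dk /qid <-; have [c ->] := zP x.
  have [g gE] := linear_pack (rlin k); rewrite -gE !linear_sum big1 // => i _.
  rewrite !linearZ /= gE (upK (d i)) ?scaler0 //.
  by apply: leq_trans dk; apply: leq_bigmax.
exists (\max_i d i); set k0 := \max_i d i.
elim=> [|m IH]; first by rewrite leqn0 => /eqP ->.
rewrite leq_eqVlt ltnS => /orP[/eqP -> //|k0m]; rewrite -IH //.
apply/seteqP; split; first exact: decI.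
move=> x Ix; have Ux : U (x - p m.+1 x).
  exists m.+1; rewrite /= rB rid // [r m _]rid; last by apply: decI; apply: (pP _).1.
  by rewrite linearB /= [p _ (p _ _)](pP _).2 ?subrr //; apply: (pP _).1.
have := UK _ _ k0m Ux; rewrite rB rid // [r m _]rid; last first.
  by apply: decI; apply: (pP _).1.
by move/eqP; rewrite subr_eq0 => /eqP ->; apply: (pP _).1.
Qed.

Section Subalgebra.
Variables (R : comNzRingType) (S : comAlgType R) (A : set S).
Hypothesis sA : subalgebras S A.

Lemma subalg1 : A 1. Proof. by case: sA => + _ _; rewrite inE. Qed.

Lemma subalgZD a x y : A x -> A y -> A (a *: x + y).
Proof. by case: sA => _ + _; move=> /(_ a x y); rewrite !inE. Qed.

Lemma subalgM x y : A x -> A y -> A (x * y).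
Proof. by case: sA => _ _ /(_ x y); rewrite !inE. Qed.

Lemma subalgB x y : A x -> A y -> A (x - y).
Proof. by move=> Ax Ay; rewrite addrC -scaleN1r; apply: subalgZD. Qed.

Lemma subalg0 : A 0.
Proof. by rewrite -(subrr 1); apply: subalgB; apply: subalg1. Qed.

Lemma subalgZ a x : A x -> A (a *: x).
Proof. by move=> Ax; rewrite -[_ *: _]addr0; apply: subalgZD => //; apply: subalg0. Qed.

Definition subalg_pred : {pred S} := fun x => x \in A.

Lemma subalg_pred_closed : GRing.subring_closed subalg_pred.
Proof.
split=> [|x y|x y]; rewrite !unfold_in /=; rewrite !inE.
- exact: subalg1.
- exact: subalgB.
- exact: subalgM.
Qed.

End Subalgebra.

(** The proof is an argument of the type because the ring structure depends on
    it. *)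
Definition subalg_type (R : comNzRingType) (S : comAlgType R) (A : set S)
  of subalgebras S A := {x : S | subalg_pred A x}.

Section SubalgebraProjection.
Variables (R : comNzRingType) (S : comAlgType R) (A : set S).
Hypothesis sA : subalgebras S A.

Local Notation B := (subalg_type sA).

HB.instance Definition _ := SubChoice.on B.
HB.instance Definition _ :=
  GRing.SubChoice_isSubComNzRing.Build S (subalg_pred A) B (subalg_pred_closed sA).

(** Ideals of A are R-submodules of the finite module S, so A is Artinian; it
    is reduced as a subring of S. *)
Lemma subalg_idem n (z : 'I_n -> S) : idem_ideals R -> spanning z ->
  reduced_ring S -> idem_ideals B.
Proof.
move=> idR zP redS; have valB (b : B) : A (val b) by have /set_mem := valP b.
apply: artinian_reduced_idem => [I sI decI|x d xd]; last first.
  apply: val_inj; rewrite raddf0; apply: (redS _ d).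
  by rewrite -rmorphXn xd raddf0.
pose J k : set S := [set val b | b in I k].
have [||k kP] := @idem_dcc R S n z J idR zP.
- move=> k; have {}sI : submodule (I k) by apply/submoduleP.
  split=> [|c _ _ [x Ix <-] [y Iy <-]].
    by exists 0; [apply: submodule0 | apply: raddf0].
  have cB : subalg_pred A c%:A.
    by apply/mem_set; apply: (subalgZ sA); apply: subalg1.
  pose c' : B := exist _ c%:A cB.
  exists (c' * x + y); first exact: (sI.2 c').
  by rewrite raddfD [X in X + _](rmorphM val c' x) /= mulr_algl.
- by move=> k _ [x Ix <-]; exists x => //; apply: decI.
exists k => m /kP e; apply/seteqP; split=> x Ix.
  have : J m (val x) by exists x.
  by rewrite e => -[y Iy /val_inj <-].
have : J k (val x) by exists x.
by rewrite -e => -[y Iy /val_inj <-].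
Qed.

Lemma subalg_projection : idem_ideals B -> exists p : S -> S,
  [/\ forall x, A (p x), forall a x, A a -> p (a * x) = a * p x,
      forall x y, p (x + y) = p x + p y & forall a, A a -> p a = a].
Proof.
move=> idB; pose v : {rmorphism B -> S} := val.
have [|p [pA pid]] := submodule_projection idB (E := restr v) (N := A).
  split=> [|a x y Ax Ay]; first exact: (subalg0 sA).
  have Aa : A (v a) by have /set_mem := valP a.
  by have := subalgZD sA 1 (subalgM sA Aa Ax) Ay; rewrite scale1r.
exists p; split=> // [a x Aa|x y]; last exact: linearD.
exact: (linearZ_LR p (exist _ a (mem_set Aa) : B) x).
Qed.

End SubalgebraProjection.

(** * Separating points by morphisms to fields *)

Lemma pzring_field (Q : comPzRingType) : (1 : Q) != 0 ->
  (forall x : Q, x != 0 -> exists y, y * x = 1) ->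
  exists (K : fieldType) (f : {rmorphism Q -> K}), injective f.
Proof.
move=> Q1 Qinv.
have /choice[inv invP] (x : Q) : exists y, (x != 0 -> y * x = 1) /\ (x = 0 -> y = 0).
  have [->|x0] := eqVneq x 0; first by exists 0.
  by have [y yx] := Qinv x x0; exists y; split=> // /eqP; rewrite (negPf x0).
pose K1 : comNzRingType := HB.pack (Q : Type) (GRing.ComPzRing.class Q)
  (GRing.PzSemiRing_isNonZero.Build Q Q1).
have mulVf (x : K1) : x != 0 -> inv x * x = 1 by exact: (invP x).1.
have inv0 : inv (0 : K1) = 0 by exact: (invP _).2.
pose K : fieldType := HB.pack (Q : Type) (GRing.ComNzRing.class K1)
  (GRing.ComNzRing_isField.Build K1 mulVf inv0).
pose f (x : Q) : K := x.
have fB : zmod_morphism f by [].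
have fM : monoid_morphism f by [].
pose F : {rmorphism Q -> K} := HB.pack f
  (GRing.isZmodMorphism.Build Q K f fB) (GRing.isMonoidMorphism.Build Q K f fM).
by exists K, F.
Qed.

(** A maximal proper ideal containing I, given by Zorn's lemma, has a quotient
    which is a field. *)
Lemma residue_field (T : comPzRingType) (I : set T^o) : submodule I -> ~ I 1 ->
  exists (K : fieldType) (f : {rmorphism T -> K}), forall x, I x -> f x = 0.
Proof.
move=> sI I1.
(* As the union of the empty chain is empty, the ideals containing I are encoded as
   X `|` I. *)
pose P (X : set T^o) := submodule (X `|` I) /\ ~ X 1.
have [|X [[sX X1] maxX]] := @Zorn_bigcup _ P.
  move=> F FP totF; split=> [|[X FX]]; last exact: (FP X FX).2.
  split=> [|a x y]; first by right; apply: sI.1.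
  have one Y z c : F Y -> (Y `|` I) z -> (\bigcup_(X in F) X `|` I) (c *: z).
    move=> FY Yz; case: (submoduleZ (FP _ FY).1 c Yz) => [Yc|]; last by right.
    by left; exists Y.
  case=> [[Y FY Yx]|Ix].
    case=> [[Z FZ Zy]|Iy].
      have [W [FW Wx Wy]] : exists W, [/\ F W, W x & W y].
        by case: (totF _ _ FY FZ) => s; [exists Z | exists Y]; split => //; apply: s.
      by case: ((FP _ FW).1.2 a x y (or_introl Wx) (or_introl Wy)) => [Wc|];
        [left; exists W | right].
    by case: ((FP _ FY).1.2 a x y (or_introl Yx) (or_intror Iy)) => [Wc|];
        [left; exists Y | right].
  case=> [[Z FZ Zy]|Iy]; last by right; apply: sI.2.
  by case: ((FP _ FZ).1.2 a x y (or_intror Ix) (or_introl Zy)) => [Wc|];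
        [left; exists Z | right].
pose M : set T := X `|` I.
have M1 : ~ M 1 by case.
have maxM (x : T) : ~ M x -> exists y, M (1 - y * x).
  move=> Mx; apply: contrapT => nM.
  pose U : set T^o := [set u | exists m a, M m /\ u = m + a * x :> T].
  have MU : M `<=` U by move=> m Mm; exists m, 0; rewrite mul0r addr0.
  apply: (maxX U); last split.
  - split=> [u Xu|/(_ x) UX]; first by apply: MU; left.
    apply: Mx; left; apply: UX; exists 0, 1; split; first exact: sX.1.
    by rewrite mul1r add0r.
  - have -> : U `|` I = U.
      by apply/seteqP; split=> [u [//|Iu]|u]; [apply: MU; right | left].
    split=> [|a _ _ [m [b [Mm ->]]] [m' [b' [Mm' ->]]]].
      by apply: MU; apply: sX.1.
    exists (a * m + m'), (a * b + b'); split; first exact: (sX.2 a).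
    by rewrite -[a *: _]/(a * _) mulrDr mulrDl mulrA addrACA.
  - move=> [m [b [Mm e]]]; apply: nM; exists b.
    by rewrite e addrK.
have qM (x : T) : qrpi M x = 0 <-> M x.
  rewrite -(rmorph0 (qrpi M)) qrpi_eq subr0; split; last exact: sub_mspan.
  by apply: (mspan_min sX).
have [||K [f finj]] := @pzring_field (quotring M).
- by apply/eqP; rewrite -(rmorph1 (qrpi M)) qM.
- move=> q q0; rewrite -[q]qrreprK in q0 *; set x := qrrepr q in q0 *.
  have [|y My] := maxM x; first by move=> /qM /eqP; rewrite (negPf q0).
  exists (qrpi M y); apply/eqP; rewrite eq_sym -subr_eq0 -rmorphM.
  by rewrite -(rmorph1 (qrpi M)) -rmorphB; apply/eqP/qM.
exists K, (f \o qrpi M) => x Ix /=.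
by rewrite (_ : qrpi M x = 0) ?rmorph0 //; apply/qM; right.
Qed.

(** In T = S (x) S let I be the ideal generated by the a (x) 1 - 1 (x) a for a
    in A, and w = s (x) 1 - 1 (x) s. If p is an A-linear projection of S onto
    A, then x (x) y |-> x p(y) kills I but not w. As w generates the same
    ideal as the idempotent w b, the ideal I + (1 - w b) is proper, and f, g
    are the two maps from S to a residue field of T at it. *)
Lemma hom_separation (R : comNzRingType) (S : comAlgType R) (A : set S)
    (s : S) n (z : 'I_n -> S) :
  idem_ideals R -> separable_algebra S -> spanning z -> subalgebras S A -> ~ A s ->
  exists (K : fieldType) (f g : {rmorphism S -> K}),
    (forall a, A a -> f a = g a) /\ f s <> g s.
Proof.
move=> idR sepS zP sA As; pose T := talg S.
have idT : idem_ideals T := separable_talg_idem sepS idR.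
have redS : reduced_ring S := idem_reduced (separable_idem sepS idR).
have [p [pA pM pD pid]] := subalg_projection (subalg_idem (sA := sA) idR zP redS).
pose delta (a : S) : T := tleft a - tright a.
pose I : set T^o := @mspan T T^o [set delta a | a in A].
pose w := delta s.
have sI : submodule I := mspan_submodule _.
(* N is the largest ideal of T on which x (x) y |-> x p(y) vanishes. *)
have Iw : ~ I w.
  have fb : bilinear_map (fun x y : S => x * p y).
    have pZ c u : p (c *: u) = c *: p u.
      by rewrite -mulr_algl pM ?mulr_algl //; apply/(subalgZ sA)/(subalg1 sA).
    split=> [y|x] c u v; first by rewrite mulrDl scalerAl.
    by rewrite pD pZ mulrDr scalerAr.
  have [F FE] := linear_pack (tlift_linear fb).
  have FT x y : F (tens x y) = x * p y by rewrite FE tliftE.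
  have FB (u v : T) : F (u - v : T) = F u - F v by apply: linearB.
  have FD (u v : T) : F (u + v : T) = F u + F v by apply: linearD.
  pose N : set T^o := [set t : T | forall u : T, F (u * t : T) = 0].
  have sN : submodule N.
    split=> [u|a t t' Nt Nt' u]; first by rewrite mulr0; apply: linear0.
    by rewrite mulrDr FD Nt' addr0 -[a *: t]/(a * t) mulrA Nt.
  have : I `<=` N.
    apply: (mspan_min sN) => _ [a Aa <-] u; rewrite mulrBr FB.
    elim/tens_ind: u => [|x y t IH]; first by rewrite !mul0r subrr.
    rewrite !mulrDl !FD opprD addrACA IH addr0.
    have -> : (tens x y : T) * tleft a = tens (x * a) y.
      by apply: etrans (tmulE _ _ _ _) _; rewrite mulr1.
    have -> : (tens x y : T) * tright a = tens x (y * a).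
      by apply: etrans (tmulE _ _ _ _) _; rewrite mulr1.
    by rewrite !FT [y * a]mulrC pM // mulrA subrr.
  move=> IN /IN /(_ 1); rewrite mul1r FB [F (tleft s)]FT [F (tright s)]FT.
  rewrite mul1r pid; last exact: subalg1.
  by rewrite mulr1 => /eqP; rewrite subr_eq0 => /eqP e; apply: As; rewrite e.
have [b wb] := idem_vnr idT w.
pose c := 1 - w * b.
pose J : set T^o := [set t : T | exists i u : T, I i /\ t = i + u * c].
have [||K [f fJ]] := @residue_field T J.
- split=> [|a _ _ [i [u [Ii ->]]] [j [v [Ij ->]]]].
    exists 0, 0; split; first exact: sI.1.
    by rewrite mul0r addr0.
  exists (a * i + j), (a * u + v); split; first exact: (sI.2 a).
  by rewrite -[a *: _]/(a * _) mulrDr mulrDl mulrA addrACA.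
- move=> [i [u [Ii e]]]; apply: Iw.
  have -> : w = w * i.
    rewrite -[w in LHS]mulr1 e /c mulrDr mulrCA mulrBr mulr1 mulrA.
    by rewrite [w * w * b]mulrAC -wb subrr mulr0 addr0.
  exact: (submoduleZ sI).
exists K, (f \o tleft (S := S)), (f \o tright (S := S)); split=> [a Aa|] /=.
  apply/eqP; rewrite -subr_eq0 -rmorphB; apply/eqP/fJ.
  exists (delta a), 0; rewrite mul0r addr0; split=> //.
  by apply: sub_mspan; exists a.
have fw : f c = 0.
  apply: fJ; exists 0, 1; rewrite mul1r add0r; split=> //; exact: sI.1.
move=> e; move/eqP: fw; rewrite /c rmorphB rmorphM /w /delta rmorphB /= e.
by rewrite subrr mul0r subr0 rmorph1 oner_eq0.
Qed.

(** * Families of morphisms to a field *)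

(** K as an R-algebra through f. *)
Definition ralg (R K : comNzRingType) (f : {rmorphism R -> K}) : Type := K.

Section RAlg.
Variables (R K : comNzRingType) (f : {rmorphism R -> K}).
HB.instance Definition _ := GRing.ComNzRing.on (ralg f).
Definition ralg_scale (c : R) (x : ralg f) : ralg f := (f c * (x : K) : K).
Lemma ralg_scaleA a b x : ralg_scale a (ralg_scale b x) = ralg_scale (a * b) x.
Proof. by rewrite /ralg_scale rmorphM mulrA. Qed.
Lemma ralg_scale1 : left_id 1 ralg_scale.
Proof. by move=> x; rewrite /ralg_scale rmorph1; apply: mul1r. Qed.
Lemma ralg_scaleDr : right_distributive ralg_scale +%R.
Proof. by move=> a x y; apply: mulrDr. Qed.
Lemma ralg_scaleDl x : {morph ralg_scale^~ x : a b / a + b}.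
Proof. by move=> a b; rewrite /ralg_scale rmorphD; apply: mulrDl. Qed.
HB.instance Definition _ := GRing.Zmodule_isLmodule.Build R (ralg f)
  ralg_scaleA ralg_scale1 ralg_scaleDr ralg_scaleDl.
Lemma ralg_scaleAl (a : R) (x y : ralg f) : a *: (x * y) = a *: x * y.
Proof. exact: mulrA. Qed.
HB.instance Definition _ := GRing.Lmodule_isLalgebra.Build R (ralg f) ralg_scaleAl.
HB.instance Definition _ := GRing.Lalgebra_isComAlgebra.Build R (ralg f).
End RAlg.

(** A residue field of K (x)_R L is wanted. That ring is the direct factor of
    P (x) P, for the product algebra P = K x L, cut out by the idempotent e =
    (1, 0) (x) (0, 1). It is nonzero: there are linear forms k1, k2 on P such
    that f maps k1 (1, 0) to 1 and g maps k2 (0, 1) to 1; the product of these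
    two values is nonzero, because f and g have the same kernel, and it is the
    value at e of a bilinear form. *)
Lemma field_amalgam (R : comNzRingType) (K L : fieldType)
    (f : {rmorphism R -> K}) (g : {rmorphism R -> L}) :
  idem_ideals R -> (forall c, f c = 0 <-> g c = 0) ->
  exists (Q : fieldType) (u : {rmorphism K -> Q}) (v : {rmorphism L -> Q}),
    forall c, u (f c) = v (g c).
Proof.
move=> idR fg.
pose P : comAlgType R := (ralg f * ralg g)%type; pose T := talg P.
pose iK (x : K) : T := tens ((x : ralg f), 0 : ralg g) (0 : ralg f, 1 : ralg g).
pose iL (y : L) : T := tens (1 : ralg f, 0 : ralg g) (0 : ralg f, (y : ralg g)).
have tM (a b c d : P) : (tens a b : T) * tens c d = tens (a * c) (b * d) :> T.
  exact: tmulE.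
have pM (a b : ralg f) (c d : ralg g) : ((a, c) : P) * (b, d) = (a * b, c * d) by [].
have iKM x y : iK (x * y) = iK x * iK y by rewrite /iK tM !pM !mulr0 mulr1.
have iLM x y : iL (x * y) = iL x * iL y by rewrite /iL tM !pM !mulr0 mulr1.
have iKB x y : iK (x - y) = iK x - iK y.
  rewrite /iK -scaleN1r -[_ *: tens _ _]tensZl -tensDl; congr tens.
  by rewrite scaleN1r; congr pair; rewrite /= subr0.
have iLB x y : iL (x - y) = iL x - iL y.
  rewrite /iL -scaleN1r -[_ *: tens _ _]tensZr -tensDr; congr tens.
  by rewrite scaleN1r; congr pair; rewrite /= subr0.
pose e : T := tens (1 : ralg f, 0 : ralg g) (0 : ralg f, 1 : ralg g).
have ee : e * e = e by rewrite -(iKM 1 1) mulr1.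
have iKL c : iK (f c) = iL (g c).
  have fc : (f c : ralg f, 0 : ralg g) = c *: (1, 0) :> P.
    by congr pair; [rewrite /= /GRing.scale /= /ralg_scale mulr1 | rewrite /= scaler0].
  have gc : (0 : ralg f, g c : ralg g) = c *: (0, 1) :> P.
    by congr pair; [rewrite /= scaler0 | rewrite /= /GRing.scale /= /ralg_scale mulr1].
  by rewrite /iK /iL fc gc tensZl tensZr.
have e0 : e <> 0.
  have unit_form (p : P) : exists k : {linear P -> R^o}, k p *: p = p.
    have [|h hE] := @linear_pack R R^o P (fun c => (c : R) *: p).
      by move=> a x y; rewrite scalerDl scalerA.
    have [k kP] := quasi_inverse idR h; exists k.
    by have := kP 1; rewrite !hE scale1r.
  have [k1 /(congr1 fst) k1P] := unit_form (1, 0).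
  have [k2 /(congr1 snd) k2P] := unit_form (0, 1).
  have fb : bilinear_map (fun x y : P => (k1 x : R) * k2 y : R^o).
    split=> [y|x] a u v; first by rewrite linearP mulrDl -mulrA.
    by rewrite linearP mulrDr mulrCA.
  have [F FE] := linear_pack (tlift_linear fb) => e0.
  have : F e = 0 by rewrite e0 linear0.
  rewrite FE tliftE //.
  have fk : f (k1 (1, 0)) = 1 by rewrite -[LHS]mulr1; exact: k1P.
  have gk : g (k2 (0, 1)) = 1 by rewrite -[LHS]mulr1; exact: k2P.
  move=> /(congr1 f); rewrite rmorphM fk mul1r rmorph0 => /fg /eqP.
  by rewrite gk oner_eq0.
have [||Q [q qP]] := @residue_field T [set t | exists u : T, t = u * (1 - e)].
- split=> [|a _ _ [u ->] [v ->]]; first by exists 0; rewrite mul0r.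
  by exists (a * u + v); rewrite mulrDl -mulrA.
- move=> [u eu]; apply: e0; rewrite -[e]mul1r eu -mulrA mulrBl mul1r ee subrr.
  exact: mulr0.
have qe : q e = 1.
  apply/esym/eqP; rewrite -subr_eq0 -(rmorph1 q) -rmorphB; apply/eqP/qP.
  by exists 1; rewrite mul1r.
have uM : monoid_morphism (q \o iK).
  by split=> [|x y] /=; [exact: qe | rewrite iKM rmorphM].
have uB : zmod_morphism (q \o iK) by move=> x y /=; rewrite iKB rmorphB.
have vM : monoid_morphism (q \o iL).
  by split=> [|x y] /=; [exact: qe | rewrite iLM rmorphM].
have vB : zmod_morphism (q \o iL) by move=> x y /=; rewrite iLB rmorphB.
pose u : {rmorphism K -> Q} := HB.pack (q \o iK)
  (GRing.isZmodMorphism.Build K Q _ uB) (GRing.isMonoidMorphism.Build K Q _ uM).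
pose v : {rmorphism L -> Q} := HB.pack (q \o iL)
  (GRing.isZmodMorphism.Build L Q _ vB) (GRing.isMonoidMorphism.Build L Q _ vM).
by exists Q, u, v => c; rewrite /= iKL.
Qed.

(** Dedekind's argument, by induction on the number of nonzero coefficients:
    if c j != 0 with f j s <> f i s, the coefficients c l (f l s - f i s) also
    give a relation, from which the index i has disappeared. *)
Lemma dedekind_independence (S : pzRingType) (K : fieldType) m
    (f : 'I_m -> {rmorphism S -> K}) (c : 'I_m -> K) :
  (forall i j, i != j -> exists s, f i s <> f j s) ->
  (forall s, \sum_i c i * f i s = 0) -> forall i, c i = 0.
Proof.
move=> fdist; have [d] := ubnP #|[set i | c i != 0]%SET|.
elim: d c => [//|d IH] c cd c0 i; apply/eqP; apply: contrapT => /negP ci.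
have cj j : j != i -> c j = 0.
  move=> ji; have [s fs] := fdist _ _ ji.
  have : c j * (f j s - f i s) = 0.
    apply: (IH (fun l => c l * (f l s - f i s))) => [|t].
      rewrite ltnS in cd; apply: leq_trans cd; apply: proper_card; apply/properP; split.
        by apply/fintype.subsetP => l; rewrite !inE mulf_eq0 negb_or => /andP[].
      by exists i; rewrite !inE ?ci // subrr mulr0 eqxx.
    under eq_bigr do rewrite mulrBr mulrBl -mulrA -rmorphM mulrAC.
    by rewrite sumrB c0 -mulr_suml c0 mul0r subrr.
  by move/eqP; rewrite mulf_eq0 subr_eq0 => /orP[/eqP //|/eqP].
have := c0 1; rewrite (bigD1 i) //= big1 => [|j /cj ->]; last exact: mul0r.
by rewrite rmorph1 mulr1 addr0 => /eqP; rewrite (negPf ci).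
Qed.

(** Independence says that the m x n matrix of the values f i (b j) has free
    rows. *)
Lemma distinct_homs_le (S : pzRingType) (K : fieldType) m n
    (f : 'I_m -> {rmorphism S -> K}) (b : 'I_n -> S) :
  (forall i j, i != j -> exists s, f i s <> f j s) ->
  (forall s, exists c : 'I_n -> K, forall i, f i s = \sum_j c j * f i (b j)) ->
  (m <= n)%N.
Proof.
move=> fdist span; pose V : 'M[K]_(m, n) := \matrix_(i, j) f i (b j).
suff /eqP <- : row_free V by exact: rank_leq_col.
rewrite -kermx_eq0; apply/rowV0P => v /sub_kermxP vV.
apply/rowP => i; rewrite mxE.
apply: (dedekind_independence fdist (c := fun i => v 0 i)) => s.
have [c cs] := span s; under eq_bigr do rewrite cs mulr_sumr.
rewrite exchange_big big1 // => j _.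
have /matrixP/(_ 0 j) := vV; rewrite !mxE => vj.
transitivity (c j * \sum_i v 0 i * V i j); last by rewrite vj mulr0.
by rewrite mulr_sumr; apply: eq_bigr => l _; rewrite mxE mulrCA.
Qed.

(** A spanning family of minimal size is a basis. It is proved for rings with
    inverses rather than for a [fieldType] because the residue rings [quotring
    M] only carry a ring structure. *)
Lemma basis_of_spanning (Q : comPzRingType) (E : lmodType Q) n (z : 'I_n -> E) :
  (forall x : Q, x != 0 -> exists y, y * x = 1) -> spanning z ->
  exists m (b : 'I_m -> E), bijective (fun c : {ffun 'I_m -> Q} => \sum_i c i *: b i).
Proof.
move=> Qinv zP; pose P m := `[< exists b : 'I_m -> E, spanning b >].
have exP : exists m, P m by exists n; apply/asboolP; exists z.
case: (ex_minnP exP) => m /asboolP[b bP] minm; exists m, b.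
have /choice[g gP] u : exists c : {ffun 'I_m -> Q}, \sum_i c i *: b i = u.
  have [c ->] := bP u; exists [ffun i => c i].
  by apply: eq_bigr => i _; rewrite ffunE.
exists g => [c|u]; last exact: gP.
apply: contrapT => /eqP ne.
have [i di] : exists i, (c - g (\sum_i c i *: b i)) i != 0.
  apply: contrapT => all0; move/eqP: ne; apply; apply/esym/ffunP => i.
  apply/eqP; rewrite -subr_eq0; apply: contrapT => /negP ne; apply: all0.
  by exists i; rewrite !ffunE.
set d := c - _ in di.
have d0 : \sum_i d i *: b i = 0.
  under eq_bigr do rewrite !ffunE scalerBl.
  by rewrite sumrB gP subrr.
case: m => [|m] in b bP minm g gP c ne i d di d0 *; first by case: i di.
have [y yd] := Qinv _ di.
suff /minm : P m by rewrite ltnn.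
apply/asboolP; exists (fun j => b (fintype.lift i j)) => u; have [a ->] := bP u.
exists (fun j => a (fintype.lift i j) - a i * (y * d (fintype.lift i j))).
have bi : b i = - \sum_j (y * d (fintype.lift i j)) *: b (fintype.lift i j).
  apply/eqP; rewrite -addr_eq0; apply/eqP.
  have := congr1 ( *:%R y) d0.
  rewrite scaler0 (bigD1_ord i) //= scalerDr scalerA yd scale1r scaler_sumr.
  move=> e; rewrite -[RHS]e; congr (_ + _).
  by apply: eq_bigr => j _; rewrite scalerA.
rewrite (bigD1_ord i) //= {1}bi scalerN scaler_sumr addrC -sumrB.
by apply: eq_bigr => j _; rewrite scalerBl scalerA.
Qed.

(** * Maximal ideals and their fibres *)

Lemma maximal_idealP (R : comNzRingType) (M : set R) : maximal_ideal M <->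
  [/\ submodule (M : set R^o), ~ M 1 & forall x, ~ M x -> exists y, M (1 - y * x)].
Proof.
have closedP (J : set R) : idealr_closed (mem J) <-> submodule (J : set R^o) /\ ~ J 1.
  split=> [[J0 J1 JD]|[[J0 JD] J1]].
    split; last by move=> Jo; move/negP: J1; apply; rewrite inE.
    by split=> [|a x y]; [rewrite inE in J0 | have := JD a x y; rewrite !inE].
  split; rewrite ?inE //; first by apply/negP; rewrite inE.
  by move=> a x y; rewrite !inE; apply: JD.
split=> [[/closedP[sM M1] maxM]|[sM M1 maxM]]; split=> //.
  move=> x Mx; apply: contrapT => nM.
  pose J : set R := [set t | exists m a, M m /\ t = m + a * x].
  have JM : J = M.
    apply: maxM => [|m Mm]; last by exists m, 0; rewrite mul0r addr0.
    apply/closedP; split.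
      split=> [|c _ _ [m [a [Mm ->]]] [m' [a' [Mm' ->]]]].
        by exists 0, 0; split; [apply: sM.1 | rewrite mul0r addr0].
      exists (c * m + m'), (c * a + a'); split; first exact: (sM.2 c).
      by rewrite -[c *: _]/(c * _) mulrDr mulrDl mulrA addrACA.
    by move=> [m [a [Mm e]]]; apply: nM; exists a; rewrite e addrK.
  apply: Mx; rewrite -JM; exists 0, 1; split; first exact: sM.1.
  by rewrite mul1r add0r.
- exact/closedP.
move=> J /closedP[sJ J1] MJ; apply/seteqP; split=> // x Jx.
apply: contrapT => /maxM[y /MJ My]; apply: J1.
by rewrite -[1](subrK (y * x)); apply: (submoduleD sJ) => //; apply: (submoduleZ sJ).
Qed.

(** For distinct maximal ideals F 0, F 1, ... the intersections of the first k
    of them form a decreasing chain; once it is stationary, F k contains the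
    intersection of the previous ones, hence one of them as it is prime. *)
Lemma finite_maximal_ideals (R : comNzRingType) :
  artinian_ring R -> finite_set [set M : set R | maximal_ideal M].
Proof.
move=> artR; apply: contrapT => /infiniteP /pcard_leP[F].
have maxF k : maximal_ideal (F k) by have := @funS _ _ _ _ F k I.
have injF : injective F by move=> i j; apply: (@inj _ _ _ F); rewrite inE.
have [|k|k stab] := artR (fun k => [set x | forall i, (i < k)%N -> F i x]).
- move=> k; apply/submoduleP; split=> [|a x y Fx Fy] i ik.
    by have /maximal_idealP[s _ _] := maxF i; apply: s.1.
  have /maximal_idealP[s _ _] := maxF i; apply: (s.2 a); [exact: Fx|exact: Fy].
- by move=> x Fx i ik; apply: Fx; apply: ltnW.
have sub i j : F i `<=` F j -> i = j.
  move=> ij; apply: injF; apply/esym; have [mi ni] := maxF i.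
  by have [cj _] := maxF j; apply: ni.
have /choice[x xP] i : exists x, i <> k -> F i x /\ ~ F k x.
  have [->|ik] := pselect (i = k); first by exists 0.
  apply: contrapT => /forallNP h; apply: ik; apply: sub => x Fx.
  by apply: contrapT => Fk; apply: (h x).
have /maximal_idealP[sk k1 maxk] := maxF k.
have primek u v : F k (u * v) -> ~ F k u -> F k v.
  move=> Fuv /maxk[y Fy].
  have -> : v = v * (1 - y * u) + y * (u * v).
    by rewrite mulrBr mulr1 mulrCA [v * u]mulrC subrK.
  by apply: (submoduleD sk); apply: (submoduleZ sk).
have prod : F k (\prod_(i < k) x i).
  have : [set x | forall i, (i < k.+1)%N -> F i x] (\prod_(i < k) x i).
    rewrite stab // => i ik; have /maximal_idealP[si _ _] := maxF i.
    rewrite (bigD1 (Ordinal ik)) //= mulrC; apply: (submoduleZ si).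
    by have [] := xP i => // e; rewrite e ltnn in ik.
  by apply.
have : forall m, (m <= k)%N -> ~ F k (\prod_(i < m) x i).
  elim=> [|m IH] mk; first by rewrite big_ord0.
  rewrite big_ord_recr /= mulrC => /primek h; apply: (IH (ltnW mk)); apply: h.
  by have [] := xP m => // e; rewrite e ltnn in mk.
by move/(_ k (leqnn k)); apply.
Qed.

(** Lifting a basis of S/MS over R/M; its size is [dimension (fibre M S)] by
    definition, provided that a basis exists, which is where spanning is used.
    *)
Lemma fibre_coordinates (R : comNzRingType) (S : comAlgType R) (M : set R) n
    (z : 'I_n -> S) : maximal_ideal M -> spanning z ->
  exists b : 'I_(dimension (fibre M S)) -> S,
  forall x, exists c : 'I_(dimension (fibre M S)) -> R,
    mspan (ideal_mul M S) (x - \sum_j c j *: b j).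
Proof.
move=> /maximal_idealP[sM M1 maxM] zP.
have fpiZ c (x : S) : fpi (c *: x) = qrpi M c *: (fpi x : fibre M S).
  by rewrite -fscale_pi.
have fpi_sum m (c : 'I_m -> R) (b : 'I_m -> S) :
    fpi (\sum_i c i *: b i) = \sum_i qrpi M (c i) *: (fpi (b i) : fibre M S).
  rewrite /fpi linear_sum; apply: eq_bigr => i _; exact: fpiZ.
have Qinv (q : quotring M) : q != 0 -> exists y, y * q = 1.
  rewrite -[q]qrreprK => q0; have [|y My] := maxM (qrrepr q).
    move=> Mq; move/eqP: q0; apply; rewrite -(rmorph0 (qrpi M)); apply/qrpi_eq.
    by rewrite subr0; apply: sub_mspan.
  exists (qrpi M y); rewrite -rmorphM -(rmorph1 (qrpi M)); apply/esym/qrpi_eq.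
  exact: sub_mspan.
have [|m [b0 bij0]] := @basis_of_spanning _ (fibre M S) n (fun i => fpi (z i)) Qinv.
  move=> q; have [c cP] := zP (frepr q); exists (fun i => qrpi M (c i)).
  by rewrite -fpi_sum -cP freprK.
have [b [g _ gK]] : exists b : 'I_(dimension (fibre M S)) -> fibre M S,
    bijective (fun c : {ffun _ -> quotring M} => \sum_i c i *: b i).
  rewrite /dimension; case: xgetP => [d _ [b bb]|/(_ m)]; first by exists b.
  by case; exists b0.
exists (fun j => frepr (b j)) => x; exists (fun j => qrrepr (g (fpi x) j)).
apply/qpi_eq; rewrite -[LHS]gK; apply/esym; apply: etrans (fpi_sum _ _ _) _.
by apply: eq_bigr => j _; rewrite qrreprK freprK.
Qed.

(** Morphisms over M factor through S/MS, so a lifted basis of the fibre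
    determines them, and [distinct_homs_le] applies. *)
Lemma homs_le_dimension (R : comNzRingType) (S : comAlgType R) (M : set R) n
    (z : 'I_n -> S) (K : fieldType) m (f : 'I_m -> {rmorphism S -> K}) :
  maximal_ideal M -> spanning z ->
  (forall i j, i != j -> exists s, f i s <> f j s) ->
  (forall i c, M c -> f i c%:A = 0) ->
  (forall i j c, f i c%:A = f j c%:A) -> (m <= dimension (fibre M S))%N.
Proof.
move=> maxM zP fdist fM fR; have [b bP] := fibre_coordinates maxM zP.
apply: (distinct_homs_le (b := b) fdist) => s; have [c cP] := bP s.
case: m => [|m] in f fdist fM fR *; first by exists (fun=> 0); case.
exists (fun j => f ord0 (c j)%:A) => i.
have ker x : mspan (ideal_mul M S) x -> f i x = 0.
  apply: (@mspan_min _ _ _ [set x | f i x = 0]).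
    split=> [|a u v /= fu fv]; first exact: rmorph0.
    by rewrite rmorphD fv addr0 -mulr_algl rmorphM fu mulr0.
  by move=> _ [a Ma [u ->]] /=; rewrite -mulr_algl rmorphM fM ?mul0r.
move: (ker _ cP); rewrite rmorphB rmorph_sum => /eqP; rewrite subr_eq0 => /eqP ->.
by apply: eq_bigr => j _; rewrite -[c j *: _]mulr_algl rmorphM -(fR i ord0).
Qed.

(** If the idempotent e generates M and e became invertible in S, it would be
    1 in S, hence in R by injectivity; so MS is proper and has a residue field
    above it. *)
Lemma hom_over_maximal (R : comNzRingType) (S : comAlgType R) (M : set R) :
  injective (GRing.in_alg S) -> idem_ideals R -> maximal_ideal M ->
  exists (K : fieldType) (f : {rmorphism S -> K}), forall c, M c -> f c%:A = 0.
Proof.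
move=> RS idR /maximal_idealP[sM M1 _]; have [e Me eP] := idR _ sM.
have [||K [f fP]] := @residue_field S [set x : S | exists y, x = y * e%:A].
- split=> [|a _ _ [u ->] [v ->]]; first by exists 0; rewrite mul0r.
  by exists (a * u + v); rewrite mulrDl -mulrA.
- move=> [y ye]; apply: M1; suff e1 : e%:A = 1 :> S.
    by have -> : 1 = e; [apply: RS; rewrite /= scale1r e1 |].
  have ee : e%:A * e%:A = e%:A :> S by rewrite mulr_algl scalerA -eP.
  by have := congr1 ( *%R^~ (e%:A : S)) ye; rewrite mul1r -mulrA ee -ye.
by exists K, f => c Mc; apply: fP; exists c%:A; rewrite mulr_algl scalerA mulrC -eP.
Qed.

(** Take a family f of maximal length m of distinct morphisms over M. In an
    amalgam of K and L over R, the morphisms g and h must coincide with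
    members of f, otherwise the family could be extended. The family is then
    padded to the size of the fibre by repeating a member. *)
Lemma universal_family (R : comNzRingType) (S : comAlgType R) (M : set R) n
    (z : 'I_n -> S) :
  injective (GRing.in_alg S) -> idem_ideals R -> spanning z -> maximal_ideal M ->
  exists (K : fieldType) (f : 'I_(dimension (fibre M S)) -> {rmorphism S -> K}),
  forall (L : fieldType) (g h : {rmorphism S -> L}),
    (forall c, g c%:A = h c%:A) -> (forall c, M c -> g c%:A = 0) ->
    exists i j, forall s, g s = h s <-> f i s = f j s.
Proof.
move=> RS idR zP maxM; have [sM M1 invM] := (maximal_idealP M).1 maxM.
pose fam m := `[< exists (K : fieldType) (f : 'I_m -> {rmorphism S -> K}),
  [/\ forall i j, i != j -> exists s, f i s <> f j s,
      forall i c, M c -> f i c%:A = 0 & forall i j c, f i c%:A = f j c%:A] >].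
have fam1 : fam 1%N.
  have [K [f fM]] := hom_over_maximal RS idR maxM.
  apply/asboolP; exists K, (fun=> f); split=> // i j.
  by rewrite !ord1 eqxx.
have fam_le m : fam m -> (m <= dimension (fibre M S))%N.
  by move=> /asboolP[K [f [fd fM fR]]]; apply: homs_le_dimension maxM zP fd fM fR.
case: (ex_maxnP (ex_intro (fun m => fam m) 1%N fam1) fam_le) => m famm maxm.
have := maxm _ fam1; have := fam_le _ famm; move/asboolP: famm => [K [f [fd fM fR]]].
case: m => // m in f fd fM fR maxm * => mn _.
(* [inord] sends the indices beyond the family to the first member. *)
exists K, (fun i => f (inord i)) => L g h gh gM.
have hM c : M c -> h c%:A = 0 by rewrite -gh; apply: gM.
have kerM (F : fieldType) (k : {rmorphism S -> F}) c :
    (forall c, M c -> k c%:A = 0) -> k c%:A = 0 <-> M c.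
  move=> kM; split=> [kc|]; last exact: kM.
  apply: contrapT => /invM[y /kM]; rewrite scalerBl scale1r rmorphB rmorph1.
  rewrite -scalerA -mulr_algl rmorphM kc mulr0 subr0 => /eqP.
  by rewrite oner_eq0.
have [|Q [u [v uv]]] := @field_amalgam R K L (f ord0 \o GRing.in_alg S)
    (g \o GRing.in_alg S) idR.
  by move=> c /=; rewrite !kerM //; apply: fM.
have among (k : {rmorphism S -> L}) : (forall c, g c%:A = k c%:A) ->
    exists i, forall s, u (f i s) = v (k s).
  move=> gk; apply: contrapT => /forallNP none.
  suff : fam m.+2 by move/maxm; rewrite ltnn.
  apply/asboolP; exists Q; pose F (i : 'I_m.+2) : {rmorphism S -> Q} :=
    if unlift ord_max i is Some j then u \o f j else v \o k.
  exists F; have FR i c : F i c%:A = u (f ord0 c%:A).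
    rewrite /F; case: (unlift ord_max i) => [j|] /=; first by rewrite (fR j ord0).
    by rewrite -gk -[LHS]uv.
  split=> [i j|i c Mc|i j c]; last by rewrite !FR.
    rewrite /F; case: unliftP => [i' ->|->]; case: unliftP => [j' ->|->] ij /=.
    - have /fd[s fs] : i' != j' by apply: contra_neq ij => ->.
      by exists s => /fmorph_inj.
    - by apply: contrapT => /forallNP h'; apply: (none i') => s; apply: contrapT => /h'.
    - apply: contrapT => /forallNP h'; apply: (none j') => s.
      by apply: contrapT => ne; apply: (h' s) => e; apply: ne.
    - by rewrite eqxx in ij.
  by rewrite FR fM ?rmorph0.
have [i iP] := among g (fun=> erefl); have [j jP] := among h gh.
exists (widen_ord mn i), (widen_ord mn j) => s; rewrite /= !inord_val.
split=> [e|e]; first by apply: (fmorph_inj u); rewrite iP jP e.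
by apply: (fmorph_inj v); rewrite -iP -jP e.
Qed.

(** * Counting subalgebras by partitions *)

(** The image of a von Neumann regular ring in a field is a field. *)
Lemma hom_kernel_maximal (R : comNzRingType) (K : fieldType) (f : {rmorphism R -> K}) :
  idem_ideals R -> maximal_ideal [set c | f c = 0].
Proof.
move=> idR; apply/maximal_idealP; split=> /= [||x fx].
- split=> [|a x y /= fx fy]; first exact: rmorph0.
  by rewrite rmorphD [f (a *: x)](rmorphM f a x) fx fy mulr0 addr0.
- by rewrite rmorph1 => /eqP; rewrite oner_eq0.
have [b xb] := idem_vnr idR x; exists b; apply: (mulfI (x := f x)); first exact/eqP.
by rewrite mulr0 -rmorphM mulrBr mulr1 mulrA -xb subrr rmorph0.
Qed.

(** If the class of s vanished in the localization of S/R, some w outside M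
    would satisfy w s in R; then f and g agree at w s and at w, with f w
    invertible, hence at s. *)
Lemma MSupp_separation (R : comNzRingType) (S : comAlgType R) (K : fieldType)
    (f g : {rmorphism S -> K}) (s : S) : idem_ideals R ->
  (forall c, f c%:A = g c%:A) -> f s <> g s ->
  MSupp (cokernel S) [set c | f c%:A = 0].
Proof.
move=> idR fg fs; split; first exact: (hom_kernel_maximal (f \o GRing.in_alg S)).
set M := [set c | f c%:A = 0].
exists (@Defs.frac R (cokernel S) (~` M) (qpi _ s) (denom1 _)).
rewrite -[0]/(lzero _ _) => /frac_eq[w].
rewrite !scaler0 scale1r -linearZ => /qpi_eq0 ws.
have wM : f (val w)%:A <> 0.
  pose P : set R := [set c | f c%:A <> 0].
  suff : P (val w) by [].
  apply: (denomP w) => //; split; rewrite ?inE.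
    by rewrite /P /= scale1r rmorph1; apply/eqP; rewrite oner_neq0.
  move=> a b; rewrite !inE /P /= => fa fb.
  rewrite -scalerA -mulr_algl rmorphM; apply/eqP.
  by rewrite mulf_neq0 //; apply/eqP.
have eqR x : mspan (range (fun r : R => r%:A : S)) x -> f x = g x.
  apply: (@mspan_min _ _ _ [set x | f x = g x]) => [|_ [r _ <-]]; last exact: fg.
  split=> [|a u v /= fu fv]; first by rewrite /= !rmorph0.
  by rewrite !rmorphD -mulr_algl !rmorphM fu fv fg.
have := eqR _ ws; rewrite -mulr_algl !rmorphM -fg => e.
by apply: fs; apply: (mulfI (x := f (val w)%:A)); [apply/eqP | exact: e].
Qed.

Definition agree (S : pzRingType) (K : fieldType) n (f : 'I_n -> {rmorphism S -> K})
  (A : set S) : rel 'I_n := fun i j => `[< forall a, A a -> f i a = f j a >].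

Definition partition_type n :=
  {P : {set {set 'I_n}} | finset.partition P [set: 'I_n]%SET}.

Lemma agree_partition (S : pzRingType) (K : fieldType) n
    (f : 'I_n -> {rmorphism S -> K})
    (A : set S) :
  exists P : partition_type n,
    forall i j, (j \in finset.pblock (val P) i) = agree f A i j.
Proof.
have eqv : {in [set: 'I_n]%SET & &, equivalence_rel (agree f A)}.
  move=> i j k _ _ _; split; first exact/asboolP.
  move=> /asboolP ij; apply/asboolP/asboolP => h a Aa; last by rewrite ij ?h.
  by rewrite -ij ?h.
exists (exist (fun P => is_true (finset.partition P [set: 'I_n]%SET)) _
  (equivalence_partitionP eqv)) => i j.
by rewrite /= pblock_equivalence_partition ?inE.
Qed.

Lemma card_partition_type n : #|{: partition_type n}| = bell n.
Proof.
by rewrite card_sig /bell; apply: eq_card => P; rewrite !inE.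
Qed.

(** P A records which members of a universal family agree on A. When P A = P
    B, a pair that agrees on A agrees on B, since it is seen by the family. *)
Lemma partition_invariant (R : comNzRingType) (S : comAlgType R) (M : set R) n
    (z : 'I_n -> S) :
  injective (GRing.in_alg S) -> idem_ideals R -> spanning z -> maximal_ideal M ->
  exists P : set S -> partition_type (dimension (fibre M S)),
  forall (L : fieldType) (g h : {rmorphism S -> L}) (A B : set S),
    (forall c, g c%:A = h c%:A) -> (forall c, M c -> g c%:A = 0) ->
    (forall a, A a -> g a = h a) -> P A = P B -> forall b, B b -> g b = h b.
Proof.
move=> RS idR zP maxM; have [K [f fP]] := universal_family RS idR zP maxM.
have /choice[P PP] := agree_partition f.
exists P => L g h A B gh gM gA PAB b Bb; have [i [j ij]] := fP L g h gh gM.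
have : agree f A i j by apply/asboolP => a Aa; apply/ij/gA.
by rewrite -PP PAB PP => /asboolP /(_ b Bb) /ij.
Qed.

Lemma card_le_fintype (T : Type) (A : set T) (F : finType) (f : T -> F) :
  {in A &, injective f} -> A #<= `I_#|F|.
Proof.
move=> finj; pose g x : nat := enum_rank (f x).
have ginj : {in A &, injective g}.
  by move=> x y Ax Ay /val_inj /enum_rank_inj; apply: finj.
rewrite -(card_le_eql (inj_card_eq ginj)).
by apply: subset_card_le => _ [x _ <-]; apply: ltn_ord.
Qed.

(** The invariants at the maximal ideals of the support jointly determine A:
    if s is in B but not in A, a pair of morphisms separating s from A lies
    over such an ideal, and the invariants of A and B there differ. *)
Lemma subalgebras_bound (R : comNzRingType) (S : comAlgType R) n (z : 'I_n -> S) :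
  injective (GRing.in_alg S) -> separable_algebra S -> artinian_ring R ->
  idem_ideals R -> spanning z ->
  subalgebras S #<=
    `I_(\big[muln/1%N]_(M \in MSupp (cokernel S)) bell (dimension (fibre M S))).
Proof.
move=> RS sepS artR idR zP.
have finM : finite_set (MSupp (cokernel S)).
  by apply: sub_finite_set (finite_maximal_ideals artR) => M [].
rewrite fsbig_finite //=.
set r : seq (set R) := finmap.enum_fset _; rewrite big_tnth.
have rP M : M \in r <-> MSupp (cokernel S) M.
  by rewrite (in_fset_set finM M : (M \in r) = _) inE.
pose M i := tnth (in_tuple r) i; pose d i := dimension (fibre (M i) S).
have MP i : maximal_ideal (M i) by have /rP[] := mem_tnth i (in_tuple r).
pose P i := projT1 (cid (partition_invariant RS idR zP (MP i))).
have PP i := projT2 (cid (partition_invariant RS idR zP (MP i))).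
pose F A : {dffun forall i, partition_type (d i)} := finfun (fun i => P i A).
have -> : \big[muln/1%N]_(i < size r) bell (dimension (fibre (tnth (in_tuple r) i) S))
    = #|{dffun forall i, partition_type (d i)}|.
  rewrite card_dep_ffun foldrE big_image /=.
  by apply: eq_bigr => i _; rewrite card_partition_type.
apply: (@card_le_fintype _ _ _ F) => A B; rewrite !inE => sA sB FAB.
have sub A' B' : subalgebras S A' -> F A' = F B' -> B' `<=` A'.
  move=> sA' e s Bs; apply: contrapT => As.
  have [K [f [g [fg fs]]]] := hom_separation idR sepS zP sA' As.
  have fgR c : f c%:A = g c%:A by apply: fg; apply: (subalgZ sA'); apply: subalg1.
  have /rP Mr := MSupp_separation idR fgR fs.
  have /tnthP[i iE] : [set c | f c%:A = 0] \in in_tuple r by [].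
  apply: fs; apply: (PP i K f g A' B' fgR) => // [c|].
    by rewrite -/(M i) /M -iE.
  by move/ffunP/(_ i): e; rewrite !ffunE.
by apply/seteqP; split; apply: sub.
Qed.

Theorem proposition6p1 (R : comNzRingType) (S : comAlgType R)
  (RS : injective (GRing.in_alg S))
  (sepS : separable_algebra S) (artR : artinian_ring R) (redR : reduced_ring R) :
  [/\ module_finite S /\ etale S,
      FIP S /\ seminormal S
    & subalgebras S #<=
        `I_(\big[muln/1%N]_(M \in MSupp (cokernel S)) bell (dimension (fibre M S)))].
Proof.
have idR := artinian_reduced_idem artR redR.
have [n [z zP]] := separable_spanning idR sepS.
have [k [x [y xy]]] := separable_casimir sepS.
have bound := subalgebras_bound RS sepS artR idR zP.
split=> //; split.
- exact: spanning_module_finite zP.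
- split; [exact: idem_flat | exact: spanning_finitely_presented zP|].
  exact: casimir_kaehler0 xy.
- exact: card_le_finite bound (finite_II _).
- by apply: idem_seminormal => //; apply: idem_reduced; apply: separable_idem.
Qed.
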